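(* Let $G$ be a finite group, let $s\in G$ be a quasi-real element and let $\rho\in\widehat{G^s}$ be an irreducible complex representation of the centralizer $G^s$ of $s$. If $\mathfrak{B}(\mathcal{O}_s,\rho)$ is not of quasi-$(-1)$-type, then $\dim\mathfrak{B}(\mathcal{O}_s,\rho)=\infty$.
   Context: All vector spaces, algebras and representations are over $\mathbb{C}$. For $s\in G$, $\mathcal{O}_s$ is the conjugacy class of $s$, $G^s$ the centralizer of $s$, and $\widehat{G^s}$ the set of isomorphism classes of irreducible complex representations of $G^s$. Yetter–Drinfeld module. Let $(\rho,V)\in\widehat{G^s}$, let $t_1=s,\dots,t_m$ be an enumeration of $\mathcal{O}_s$, and choose $g_i\in G$ with $g_i s g_i^{-1}=t_i$. Then $M(\mathcal{O}_s,\rho)=\bigoplus_{i=1}^m g_i\otimes V$, and $g_iv:=g_i\otimes v$. The coaction is $\delta(g_iv)=t_i\otimes g_iv$ and the action is $h\cdot(g_iv)=g_j(\gamma\cdot v)$, where $hg_i=g_j\gamma$ with $\gamma\in G^s$. The braiding is $c(g_iv\otimes g_jw)=t_i\cdot(g_jw)\otimes g_iv$. $\mathfrak{B}(\mathcal{O}_s,\rho)$ denotes the Nichols algebra of $M(\mathcal{O}_s,\rho)$. Since $s$ is central in $G^s$, $\rho(s)=q_{ss}\,\mathrm{id}$ for a scalar $q_{ss}\in\mathbb{C}$. Quasi-real elements. $s\in G$ is quasi-real if $s^2=1$ or there is an integer $j$ with $s^j\in\mathcal{O}_s$ and $s^j\neq s$. $s$ is strongly quasi-real if $s^2=1$ or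 there is an integer $j$ such that $s^j\in\mathcal{O}_s$ and $s,s^j,s^{j^2}$ are pairwise distinct. Quasi-$(-1)$-type. For $s$ quasi-real, $\mathfrak{B}(\mathcal{O}_s,\rho)$ is of quasi-$(-1)$-type if one of the following holds: (a) $s$ is strongly quasi-real, the order of $s$ is even, and $q_{ss}=-1$; (b) $s$ has even order, $\deg\rho>1$, and $q_{ss}=-1$; (c) $\deg\rho=1$, the order of $s$ is even, and $q_{ss}=-1$; (d) $\deg\rho=1$ and $q_{ss}$ is a primitive third root of unity. *)

(* Defs.v *)
From mathcomp Require Import all_boot all_order all_algebra all_fingroup.
From mathcomp Require Import mxrepresentation.
From mathcomp Require Import finmap monalg.

Set Implicit Arguments.
Unset Strict Implicit.
Unset Printing Implicit Defensive.

Import GRing.Theory.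

Local Open Scope ring_scope.

Section QuasiReal.
Variable gT : finGroupType.

Definition zexpg (x : gT) (j : int) : gT :=
  match j with Posz n => (x ^+ n)%g | Negz n => (x ^- n.+1)%g end.

Definition quasi_real (G : {group gT}) (s : gT) : Prop :=
  (s ^+ 2 = 1)%g \/
  exists j : int, zexpg s j \in (s ^: G)%g /\ zexpg s j <> s.

Definition strongly_quasi_real (G : {group gT}) (s : gT) : Prop :=
  (s ^+ 2 = 1)%g \/
  exists j : int, zexpg s j \in (s ^: G)%g /\
                  uniq [:: s; zexpg s j; zexpg s (j ^+ 2)].

End QuasiReal.

(* A Yetter-Drinfeld module over a group, presented on a homogeneous basis X: *)
(* the coaction is delta(x) = yd_deg x (x) x, and yd_act h x is the vector    *)
(* h . x, given by its coordinates.  Only the data are recorded: h is meant   *)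
(* to range over the group in question, on which the module axioms hold.      *)
Record yd_data (K : fieldType) (gT : finGroupType) := YDData {
  yd_basis : finType;
  yd_deg : yd_basis -> gT;
  yd_act : gT -> yd_basis -> {ffun yd_basis -> K}
}.

Section NicholsAlgebra.
Variables (K : fieldType) (gT : finGroupType) (M : yd_data K gT).

Local Notation X := (yd_basis M).
Local Notation word := {fmonom X}.

(* T(M), as the free associative algebra on the basis of M. *)
Local Notation T := {malg K[word]}.

(* The vector space T(M) (x) T(M), with basis the pairs of words. *)
Local Notation TT := {malg K[(word * word)%type]}.

Definition gen (x : X) : T := << fmu x >>.

Definition tens (a b : T) : TT :=
  \sum_(u <- msupp a) \sum_(v <- msupp b) << a@_u * b@_v *g (u, v) >>.

(* T(M) is again a Yetter-Drinfeld module: words are homogeneous, of degree   *)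
(* the product of the degrees of their letters, and the group acts by algebra *)
(* automorphisms.                                                             *)
Definition wdeg (w : word) : gT := (\prod_(x <- fmonom_val w) yd_deg x)%g.

Definition wact (h : gT) (w : word) : T :=
  \prod_(x <- fmonom_val w) \sum_(y : X) yd_act h x y *: gen y.

(* The product of T(M) (x) T(M) twisted by the braiding:                      *)
(*   (a (x) b) (a' (x) b') = a (b_(-1) . a') (x) b_(0) b'.                    *)
Definition braided_mul (A B : TT) : TT :=
  \sum_(p <- msupp A) \sum_(q <- msupp B)
    (A@_p * B@_q) *:
      tens (<< p.1 >> * wact (wdeg p.2) q.1) (<< p.2 >> * << q.2 >>).

(* The algebra map T(M) -> T(M) (x) T(M) for the twisted product making the   *)
(* elements of M primitive.                                                   *)
Definition wcomul (w : word) : TT :=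
  foldr (fun x => braided_mul (tens (gen x) 1 + tens 1 (gen x)))
        (tens 1 1) (fmonom_val w).

Definition comul (a : T) : TT := \sum_(w <- msupp a) a@_w *: wcomul w.

Definition hcomp (n : nat) (a : T) : T :=
  \sum_(w <- msupp a | fdeg w == n) << a@_w *g w >>.

(* Homogeneous two-sided ideals I of T(M) which lie in degrees >= 2 and are   *)
(* coideals: comul I is contained in I (x) T(M) + T(M) (x) I.                 *)
Record homogeneous_coideal (I : T -> Prop) : Prop := {
  hc_zero : I 0;
  hc_lin : forall (c : K) a b, I a -> I b -> I (c *: a + b);
  hc_mull : forall a b, I b -> I (a * b);
  hc_mulr : forall a b, I a -> I (a * b);
  hc_hom : forall n a, I a -> I (hcomp n a);
  hc_deg : forall a, I a -> {in msupp a, forall w, (2 <= fdeg w)%N};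
  hc_comul : forall a, I a ->
    exists r : seq (T * T), {in r, forall p, I p.1 \/ I p.2} /\
      comul a = \sum_(p <- r) tens p.1 p.2
}.

(* The defining ideal J of the Nichols algebra B(M) = T(M) / J: the sum of    *)
(* all ideals as above.                                                       *)
Definition nichols_ideal (a : T) : Prop :=
  exists r : seq T,
    {in r, forall b, exists I, homogeneous_coideal I /\ I b} /\
    a = \sum_(b <- r) b.

(* B(M) = T(M) / J is spanned by the classes of finitely many elements. *)
Definition nichols_findim : Prop :=
  exists (n : nat) (b : 'I_n -> T), forall a : T,
    exists c : 'I_n -> K, nichols_ideal (a - \sum_(i < n) c i *: b i).

End NicholsAlgebra.

Section InducedModule.
Variables (K : fieldType) (gT : finGroupType) (G : {group gT}) (s : gT).
Variables (d : nat) (rho : mx_representation K 'C_G[s] d).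

Definition coset_reps (g : gT -> gT) : Prop :=
  {in (s ^: G)%g, forall t, g t \in G /\ (g t * s * (g t)^-1 = t)%g}.

(* M(O_s, rho) for coset representatives g, with basis the g_t (x) e_k, t in  *)
(* O_s.  The matrices rho act on column vectors, so that rho gamma e_k is the *)
(* k-th column of rho gamma and V is a left module (mx_irreducible refers to  *)
(* row vectors; taking annihilators shows that it is the same condition).     *)
(* The vector h . (g_t e_k) has components only on those g_t' e_l for which   *)
(* h g_t = g_t' gamma with gamma in the centralizer.                          *)
Definition class_yd (g : gT -> gT) : yd_data K gT :=
  let X : finType := ({t : gT | t \in (s ^: G)%g} * 'I_d)%type in
  @YDData K gT X
    (fun x : X => val x.1)
    (fun h (x : X) => [ffun y : X =>
       let gamma := ((g (val y.1))^-1 * (h * g (val x.1)))%g in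
       if gamma \in 'C_G[s]%g then rho gamma y.2 x.2 else 0]).

(* The scalar q is q_ss. *)
Definition quasi_minus1_type : Prop :=
  exists q : K, rho s = q%:M /\
    [\/ [/\ strongly_quasi_real G s, ~~ odd #[s]%g & q = -1],
        [/\ ~~ odd #[s]%g, (1 < d)%N & q = -1],
        [/\ d = 1%N, ~~ odd #[s]%g & q = -1]
      | d = 1%N /\ 3.-primitive_root q].

End InducedModule.

(* Main.v *)
Require Import Defs.
From mathcomp Require Import all_boot all_order all_algebra all_fingroup.
From mathcomp Require Import mxrepresentation reals complex.
From HB Require Import structures.
From mathcomp Require Import finmap monalg boolp ring zify.

(** Let q be the scalar by which the central element s of its centralizer acts,
    and M its order.  For a power t = s^b of s that is conjugate to s, the
    element s^c acts on g_t (x) e by the scalar q^(c / b).  Hence the basis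
    vectors sitting over powers of s span a braided subspace of diagonal type,
    in which every letter has self-braiding q and every product p_ij p_ji of
    opposite braidings is a power of q.  If M = 1 one letter already generates a
    polynomial ring.  If M = 2, or if M = 3 and rho has degree one, the pair is
    of quasi-(-1)-type.  In every other case two or three letters can be chosen
    so that p_ij p_ji = q^(- a) for a fixed a < M, with a at least 2 for two
    letters and a = 1 for three ([finite_class_order]).  This is a braiding of
    Cartan type whose Cartan matrix (diagonal 2, off-diagonal - a) has row sums
    at most 0, so it is not of finite type, and [cartan_infinite] says that
    the Nichols algebra is then infinite-dimensional.

    That theorem is proved by reflections, in the quantum shuffle model: the
    Nichols algebra of a diagonal braiding p is the algebra generated by the
    operators [shuf p i] on functions of words, whose defining relation with the
    derivations [lder j] is [lder_shuf].  Fix a letter i.  The derivation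
    [lder i] and the root vectors (ad x_i)^(a_k) (x_k), k <> i, behave like the
    letters of the reflected braiding: [refl_der_op] exhibits operators that act
    on them as skew derivations do.  As an element of a Nichols algebra vanishes
    as soon as all its iterated derivatives do ([zero_of_der_stable]), a nonzero
    word for the reflected braiding gives a nonzero operator for the original
    one, and so a nonzero word of the reflected degree or of a larger one
    ([reflect_zero]).

    Suppose now that nonzero words have bounded length.  A braiding with values
    in the M-th roots of unity has only finitely many iterated reflections, so a
    longest nonzero word u exists among all of them.  Let i be its least
    frequent letter.  Some word with one letter i less is nonzero, and since the
    row sums are at most 0 its reflection at i is longer than u: a contradiction
    ([vanishing_descent]).

    The link with the ideal J that defines the Nichols algebra is
    [nichols_finite_bounded]: the component in degree one of the coproduct gives
    skew derivations preserving every homogeneous coideal, so iterating them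
    gives functionals that kill J and detect the nonzero words; if J had finite
    codimension, only finitely many degrees could carry such a word. *)

Set Implicit Arguments.
Unset Strict Implicit.
Unset Printing Implicit Defensive.

Import GRing.Theory Num.Theory.

Local Open Scope ring_scope.

(** * Quantum shuffle operators of a diagonal braiding *)

Section ShuffleOperators.
Variables (F : fieldType) (I : eqType).
Local Notation fn := (seq I -> F).
Implicit Types (f g h : fn) (A B : fn -> fn) (u v w : seq I).

(** Linearity is phrased on combinations of two terms because the commutation
    rules below all have exactly two terms. *)
Definition comb (a : F) f (b : F) g : fn := fun w => a * f w + b * g w.
Definition lin A := forall a f b g, A (comb a f b g) = comb a (A f) b (A g).

Lemma lin0 A : lin A -> A (fun=> 0) = (fun=> 0).
Proof.
move=> hA; have := hA 0 (fun=> 0) 0 (fun=> 0).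
have -> : comb 0 (fun=> 0) 0 (fun=> 0) = (fun=> 0).
  by apply: funext => w; rewrite /comb; ring.
by move=> ->; apply: funext => w; rewrite /comb; ring.
Qed.

Lemma lin_scale A a f w : lin A -> A (fun w' => a * f w') w = a * A f w.
Proof.
move=> hA; rewrite (_ : (fun w' => _) = comb a f 0 f).
  by rewrite hA /comb mul0r addr0.
by apply: funext => v; rewrite /comb mul0r addr0.
Qed.

Lemma lin_iter A n : lin A -> lin (iter n A).
Proof. by move=> hA; elim: n => // n IHn a f b g; rewrite !iterS IHn hA. Qed.

Lemma lin_sum A (J : Type) (r : seq J) (c : J -> F) (h : J -> fn) w : lin A ->
  A (fun w' => \sum_(x <- r) c x * h x w') w = \sum_(x <- r) c x * A (h x) w.
Proof.
move=> hA; elim: r => [|x r IHr].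
  rewrite big_nil (_ : (fun w' => _) = (fun=> 0)) ?lin0 //.
  by apply: funext => v; rewrite big_nil.
rewrite big_cons -IHr (_ : (fun w' => _) =
  comb (c x) (h x) 1 (fun w' => \sum_(y <- r) c y * h y w')).
  by rewrite hA /comb mul1r.
by apply: funext => v; rewrite /comb big_cons mul1r.
Qed.

Definition lder j f : fn := fun w => f (j :: w).
Definition rder j f : fn := fun w => f (rcons w j).
Definition twist (c : I -> F) f : fn := fun w => (\prod_(k <- w) c k) * f w.

Lemma lin_lder j : lin (lder j). Proof. by []. Qed.
Lemma lin_rder j : lin (rder j). Proof. by []. Qed.
Lemma lin_twist c : lin (twist c).
Proof. by move=> a f b g; apply: funext => w; rewrite /twist /comb; ring. Qed.

Lemma lder_twist c j f : lder j (twist c f) =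
  fun w => c j * twist c (lder j f) w.
Proof. by apply: funext => w; rewrite /lder /twist big_cons; ring. Qed.

Lemma rder_twist c j f : rder j (twist c f) =
  fun w => c j * twist c (rder j f) w.
Proof.
by apply: funext => w; rewrite /rder /twist -cats1 big_cat big_seq1 /=; ring.
Qed.

Lemma twist_twist b c f : twist b (twist c f) = twist (fun k => b k * c k) f.
Proof. by apply: funext => w; rewrite /twist big_split /=; ring. Qed.

Lemma twistVK c f : (forall k, c k != 0) ->
  twist c (twist (fun k => (c k)^-1) f) = f.
Proof.
move=> hc; rewrite twist_twist; apply: funext => w; rewrite /twist.
by rewrite big1 ?mul1r // => k _; rewrite mulfV.
Qed.

(** Induction on the word at which the function is evaluated: [lder j] strips
    its first letter. *)
Lemma zero_of_lder A : (forall f, A f [::] = 0) ->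
  (forall j, exists c, forall f w, A f (j :: w) = c * A (lder j f) w) ->
  forall f, A f = fun=> 0.
Proof.
move=> h0 hS f; apply: funext => w; elim: w f => [|j w IHw] f //.
by have [c ->] := hS j; rewrite IHw mulr0.
Qed.

(** Noncommutative polynomials are lists of pairs (coefficient, word), so that
    the same polynomial can be evaluated on different families of operators. *)
Definition word_op (X : I -> fn -> fn) u f := foldr X f u.
Definition poly_op (X : I -> fn -> fn) (P : seq (F * seq I)) f : fn :=
  fun w => \sum_(t <- P) t.1 * word_op X t.2 f w.

Lemma lin_word_op X u : (forall i, lin (X i)) -> lin (word_op X u).
Proof. by move=> hX; elim: u => //= i u IHu a f b g; rewrite /= IHu hX. Qed.

Lemma word_op_cat X u v f : word_op X (u ++ v) f = word_op X u (word_op X v f).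
Proof. by rewrite /word_op foldr_cat. Qed.

Definition homog u (P : seq (F * seq I)) := all (fun t => perm_eq t.2 u) P.

Section Braiding.
Variable p : I -> I -> F.

(** [shuf i] is left multiplication by the letter i in the quantum shuffle
    algebra of the braiding x_i (x) x_j |-> p_ij x_j (x) x_i.  The recursion is
    its commutation rule with [lder j]. *)
Fixpoint shuf_at i w : fn -> F :=
  if w is j :: w' then
    fun f => (i == j)%:R * f w' + p i j * shuf_at i w' (lder j f)
  else fun=> 0.
Definition shuf i f : fn := fun w => shuf_at i w f.

Lemma lder_shuf i j f : lder j (shuf i f) =
  comb (i == j)%:R f (p i j) (shuf i (lder j f)).
Proof. by []. Qed.

Lemma shuf_nil i f : shuf i f [::] = 0. Proof. by []. Qed.

Lemma lin_shuf i : lin (shuf i).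
Proof.
move=> a f b g; apply: funext => w; rewrite [RHS]/comb /shuf.
elim: w f g => [|j w IHw] f g /=; first by ring.
by rewrite (lin_lder j) IHw /comb; ring.
Qed.

(** Letters can also be removed at the right end; the new letter i must then
    travel through the whole word, which is what [twist (p i)] records. *)
Lemma rder_shuf i j f :
  rder j (shuf i f) = comb 1 (shuf i (rder j f)) (i == j)%:R (twist (p i) f).
Proof.
apply: funext => w; rewrite /comb /rder /shuf /twist.
elim: w f => [|k w IHw] f /=; first by rewrite big_nil; ring.
by rewrite big_cons IHw /lder; ring.
Qed.

Lemma twist_shuf c i f : twist c (shuf i f) =
  fun w => c i * shuf i (twist c f) w.
Proof.
apply: funext => w; elim: w f => [|k w IHw] f.
  by rewrite /twist /shuf /=; ring.
rewrite -[LHS]/(lder k (twist c (shuf i f)) w).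
rewrite -[X in _ = _ * X]/(lder k (shuf i (twist c f)) w).
rewrite lder_twist !lder_shuf lin_twist lder_twist /comb IHw lin_scale;
  last exact: lin_shuf.
by case: eqP => [->|_] /=; ring.
Qed.

(** The braided derivation by the letter j on words; [chi j u] is the scalar
    picked up by moving it through all of u. *)
Fixpoint der_word j u : seq (F * seq I) :=
  if u is i :: u' then
    (if i == j then [:: (1, u')] else [::]) ++
    [seq (p i j * t.1, i :: t.2) | t <- der_word j u']
  else [::].

Definition der_poly j (P : seq (F * seq I)) :=
  flatten [seq [seq (t.1 * t'.1, t'.2) | t' <- der_word j t.2] | t <- P].

Definition chi j u := \prod_(i <- u) p i j.

Lemma der_word_perm j u t : t \in der_word j u -> perm_eq u (j :: t.2).
Proof.
elim: u t => //= i u IHu t; rewrite mem_cat => /orP[|/mapP[t' /IHu h ->]] /=.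
  by case: eqP => // ->; rewrite inE => /eqP->.
rewrite -(perm_cons i) in h; apply: perm_trans h _.
by rewrite -[[:: i, j & _]]/([:: i] ++ [:: j] ++ _) perm_catCA.
Qed.

Lemma homog_der_poly j u P : homog u P -> homog (rem j u) (der_poly j P).
Proof.
move=> /allP hP; apply/allP => t /flattenP[s /mapP[t1 /hP h1 ->]].
case/mapP => t2 /der_word_perm h2 -> /=.
have h : perm_eq u (j :: t2.2) by apply: perm_trans h2; rewrite perm_sym.
have ju : j \in u by rewrite (perm_mem h) mem_head.
by rewrite -(perm_cons j) perm_sym; apply: perm_trans h;
  rewrite perm_sym perm_to_rem.
Qed.

Lemma der_poly0 j u P : homog u P -> j \notin u -> der_poly j P = [::].
Proof.
move=> /allP hP ju; case E: (der_poly j P) => [//|t s].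
have: t \in der_poly j P by rewrite E mem_head.
case/flattenP => s' /mapP[t1 /hP h1 ->] /mapP[t2 /der_word_perm h2 _].
by rewrite -(perm_mem h1) (perm_mem h2) mem_head in ju.
Qed.

Lemma chi_perm j u v : perm_eq u v -> chi j u = chi j v.
Proof. exact: perm_big. Qed.

Section Leibniz.
Variables (X : I -> fn -> fn) (Y : fn -> fn) (j : I).
Hypothesis linX : forall i, lin (X i).
Hypothesis linY : lin Y.
Hypothesis YX : forall i f, Y (X i f) = comb (i == j)%:R f (p i j) (X i (Y f)).

(** An operator Y that commutes with the X i as a derivation commutes with
    letters also acts on all polynomials in the X i through [der_word]. *)
Lemma leibniz_word u f :
  Y (word_op X u f) = comb 1 (poly_op X (der_word j u) f) (chi j u)
    (word_op X u (Y f)).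
Proof.
elim: u => [|i u IHu] /=.
  by apply: funext => w; rewrite /comb /poly_op /chi !big_nil; ring.
rewrite YX IHu linX; apply: funext => w.
rewrite /comb /poly_op /chi big_cat big_cons big_map /=.
rewrite (lin_sum _ _ (fun t => word_op X t.2 f)) //.
have -> : \sum_(t <- der_word j u) p i j * t.1 * X i (word_op X t.2 f) w =
    p i j * \sum_(t <- der_word j u) t.1 * X i (word_op X t.2 f) w.
  by rewrite mulr_sumr; apply: eq_bigr => t _; rewrite mulrA.
by case: eqP => _ /=; rewrite ?big_seq1 ?big_nil /=; ring.
Qed.

Lemma leibniz u P f : homog u P ->
  Y (poly_op X P f) = comb 1 (poly_op X (der_poly j P) f) (chi j u)
    (poly_op X P (Y f)).
Proof.
move=> /allP hP; apply: funext => w.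
rewrite (lin_sum _ _ (fun t => word_op X t.2 f)) // /comb /poly_op big_flatten
  big_map.
rewrite mul1r mulr_sumr -big_split /=; apply: eq_big_seq => t /hP ht.
rewrite leibniz_word /comb /poly_op big_map /= (chi_perm _ ht) mul1r mulrDr
  mulr_sumr.
congr (_ + _); last by ring.
by apply: eq_bigr => t' _; rewrite mulrA.
Qed.
End Leibniz.

Lemma lin_poly_op X P : (forall i, lin (X i)) -> lin (poly_op X P).
Proof.
move=> hX a f b g; apply: funext => w;
  rewrite /poly_op /comb !mulr_sumr -big_split.
by apply: eq_bigr => t _ /=; rewrite lin_word_op // /comb; ring.
Qed.

(** An element of positive degree of a Nichols algebra is zero when all its
    derivatives are.  Any condition on polynomials that survives derivation and
    forces constants to vanish is therefore a sufficient condition for being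
    zero. *)
Lemma zero_of_der_stable (N : seq (F * seq I) -> Prop) :
  (forall u P j, homog u P -> N P -> N (der_poly j P)) ->
  (forall P, homog [::] P -> N P -> \sum_(t <- P) t.1 = 0) ->
  forall u P, homog u P -> N P -> forall f, poly_op shuf P f = fun=> 0.
Proof.
move=> hS h0 u; move: {2}(size u) (leqnn (size u)) => n.
elim: n u => [|n IHn] u un P hP NP.
  move: un hP; rewrite leqn0 size_eq0 => /eqP-> hP f; apply: funext => w.
  transitivity ((\sum_(t <- P) t.1) * f w); last by rewrite h0 // mul0r.
  rewrite mulr_suml; apply: eq_big_seq => t /(allP hP) /perm_nilP-> //.
have [u0|u0] := eqVneq u [::]; first by apply: (IHn u) => //; rewrite u0.
apply: zero_of_lder => [f|j].
  rewrite /poly_op big1_seq // => -[c [|i v]] /andP[_ /(allP hP)] /=;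
    last by rewrite /shuf mulr0.
  by rewrite perm_sym => /perm_nilP /eqP; rewrite (negPf u0).
exists (chi j u) => f w; rewrite -[LHS]/(lder j (poly_op shuf P f) w).
rewrite (leibniz lin_shuf (@lin_lder j) (lder_shuf ^~ j) _ hP) /comb mul1r.
suff -> : poly_op shuf (der_poly j P) f = fun=> 0 by rewrite add0r.
have [ju|ju] := boolP (j \in u); last first.
  by rewrite (der_poly0 hP ju); apply: funext => v; rewrite /poly_op big_nil.
apply: (IHn (rem j u)); rewrite ?homog_der_poly //; last exact: hS hP NP.
by rewrite size_rem //; case: (size u) un.
Qed.

(** The unit of the shuffle algebra. *)
Definition unit_fn : fn := fun w => (nilp w)%:R.

(** Multiplication by an element is the zero operator as soon as the element is
    zero, that is, as soon as its product with the unit is. *)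
Lemma poly_op_unit_fn u P : homog u P -> poly_op shuf P unit_fn = (fun=> 0) ->
  forall f, poly_op shuf P f = fun=> 0.
Proof.
apply: (zero_of_der_stable (N := fun P => poly_op shuf P unit_fn =
  fun=> 0)) => [v Q j hQ NQ|Q hQ NQ].
  have := leibniz lin_shuf (@lin_lder j) (lder_shuf ^~ j) unit_fn hQ.
  rewrite NQ; have -> : lder j unit_fn = fun=> 0 by [].
  rewrite (lin0 (lin_poly_op Q lin_shuf)).
  move=> E; apply: funext => w; move/(congr1 (fun h => h w)): E.
  by rewrite /comb /lder mul1r mulr0 addr0.
apply: etrans (congr1 (fun h => h [::]) NQ); rewrite /poly_op.
by apply: eq_big_seq => t /(allP hQ) /perm_nilP-> /=; rewrite /unit_fn mulr1.
Qed.

Lemma word_op_unit_fn u : word_op shuf u unit_fn = (fun=> 0) -> forall f,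
  word_op shuf u f = fun=> 0.
Proof.
have E f : word_op shuf u f = poly_op shuf [:: (1, u)] f.
  by apply: funext => w; rewrite /poly_op big_seq1 mul1r.
move=> h f; rewrite E; apply: (@poly_op_unit_fn u);
  first by rewrite /homog /= perm_refl.
by rewrite -E.
Qed.

End Braiding.
End ShuffleOperators.

(** * Iterated braided commutators with one letter *)

Section QInt.
Variable (F : fieldType).
Definition qint (q : F) n := \sum_(k < n) q ^+ k.
Lemma qint0 q : qint q 0 = 0. Proof. by rewrite /qint big_ord0. Qed.
Lemma qintS q n : qint q n.+1 = qint q n + q ^+ n.
Proof. by rewrite /qint big_ord_recr. Qed.
Lemma qintSl q n : qint q n.+1 = 1 + q * qint q n.
Proof.
by rewrite /qint big_ord_recl mulr_sumr; congr (_ + _); apply: eq_bigr => k _;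
  rewrite -exprS.
Qed.
Lemma qint_neq0 q n : q ^+ n != 1 -> qint q n != 0.
Proof. by apply: contraNneq => h;
  rewrite -subr_eq0 subrX1 -/(qint q n) h mulr0. Qed.
End QInt.

Section AdjointOperators.
Variables (F : fieldType) (I : eqType) (p : I -> I -> F) (i : I).
Local Notation fn := (seq I -> F).
Implicit Types (f g h : fn) (u v w : seq I).
Local Notation q := (p i i).
Local Notation L := (shuf p).

(** Multiplication by the root vector (ad x_i)^m (x_j), where ad is the braided
    commutator. *)
Fixpoint ad j m : fn -> fn :=
  if m is m'.+1 then
    fun f => comb 1 (L i (ad j m' f)) (- (q ^+ m' * p i j)) (ad j m' (L i f))
  else L j.

Lemma lin_ad j m : lin (ad j m).
Proof.
elim: m => [|m IHm]; first exact: lin_shuf.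
move=> c f d g /=; rewrite (lin_shuf p i) IHm (lin_shuf p i) IHm.
by apply: funext => w; rewrite /comb; ring.
Qed.

Lemma ad_nil j m f : ad j m f [::] = 0.
Proof. by elim: m f => //= m IHm f; rewrite /comb IHm shuf_nil; ring. Qed.

Lemma twist_ad c j m f :
  twist c (ad j m f) = fun w => c i ^+ m * c j * ad j m (twist c f) w.
Proof.
elim: m f => [|m IHm] f /=; first by rewrite twist_shuf; apply: funext => w;
  rewrite expr0 mul1r.
apply: funext => w; rewrite lin_twist twist_shuf !IHm twist_shuf /comb.
rewrite (lin_scale _ _ _ (lin_ad _ _)) (lin_scale _ _ _ (lin_shuf p _)).
by rewrite exprS; ring.
Qed.

(** The braided commutator is built so that the contributions of [lder j] cancel
    once there is at least one commutator. *)
Lemma lder_ad k j m f : k != i ->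
  lder k (ad j m f) = comb ((j == k) && (m == 0%N))%:R f
                        (p i k ^+ m * p j k) (ad j m (lder k f)).
Proof.
move=> ki; elim: m f => [|m IHm] f /=.
  by rewrite lder_shuf andbT expr0 mul1r.
apply: funext => w;
  rewrite (lin_lder k) lder_shuf !IHm lder_shuf lin_shuf lin_ad.
rewrite eq_sym (negPf ki) andbF /comb exprS.
by case: (j =P k) => [->|_] /=; case: m {IHm} => [|m] /=; ring.
Qed.

Definition lder_coef j m := qint q m * (1 - q ^+ m.-1 * (p i j * p j i)).

(** The quantum sl_2 relation: [lder i] lowers the string of root vectors, and
    [lder_coef j m] vanishes where the string ends. *)
Lemma lder_ad_self j m f : j != i ->
  lder i (ad j m f) = comb (lder_coef j m) (ad j m.-1 f)
                        (q ^+ m * p j i) (ad j m (lder i f)).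
Proof.
move=> ji; elim: m f => [|m IHm] f.
  by apply: funext => w;
    rewrite /= lder_shuf (negPf ji) /lder_coef qint0 /comb /=; ring.
apply: funext => w;
  rewrite /= (lin_lder i) lder_shuf eqxx !IHm lder_shuf eqxx lin_shuf !lin_ad.
rewrite /comb /lder_coef; case: m {IHm} => [|m] /=.
  by rewrite qint0 qintS qint0 /comb; ring.
(* The two recursions for q-integers express q ^ m by [qint q m], which leaves
   a polynomial identity. *)
have h : q ^+ m = 1 + q * qint q m - qint q m by apply: (addrI (qint q m));
  rewrite -qintS qintSl; ring.
by rewrite !qintS /comb !exprS h; ring.
Qed.

Lemma rder_ad_other k j m f : k != j -> k != i -> rder k (ad j m f) =
  ad j m (rder k f).
Proof.
move=> kj ki; elim: m f => [|m IHm] f /=.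
  by apply: funext => w; rewrite rder_shuf eq_sym (negPf kj) /comb /=; ring.
apply: funext => w;
  rewrite (lin_rder k) rder_shuf !IHm rder_shuf [i == k]eq_sym (negPf ki).
by rewrite lin_ad /comb /=; ring.
Qed.

(** In contrast with [lder i], the right derivation by i annihilates the root
    vectors, hence commutes with multiplication by them. *)
Lemma rder_ad_self j m f : j != i -> rder i (ad j m f) = ad j m (rder i f).
Proof.
move=> ji; elim: m f => [|m IHm] f /=.
  by apply: funext => w; rewrite rder_shuf (negPf ji) /comb /=; ring.
apply: funext => w; rewrite (lin_rder i) rder_shuf !IHm rder_shuf eqxx twist_ad.
by rewrite lin_ad /comb /=; ring.
Qed.

Definition rder_coef j m := \prod_(k < m) (1 - q ^+ k * (p i j * p j i)).

Lemma twist_iter c n f :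
  twist c (iter n (L i) f) = fun w => c i ^+ n * iter n (L i) (twist c f) w.
Proof.
elim: n f => [|n IHn] f; apply: funext => w; first by rewrite mul1r.
by rewrite !iterS twist_shuf IHn (lin_scale _ _ _ (lin_shuf p _)) exprS mulrA.
Qed.

Lemma rder_iter n f : rder i (iter n (L i) f) =
  comb 1 (iter n (L i) (rder i f)) (qint q n) (iter n.-1 (L i) (twist (p i) f)).
Proof.
elim: n f => [|n IHn] f; apply: funext => w.
  by rewrite qint0 /comb /=; ring.
rewrite iterS rder_shuf eqxx IHn twist_iter lin_shuf qintS /comb /=.
by case: n {IHn} => [|n] /=; rewrite ?qint0; ring.
Qed.

(** The correction term says that the right derivative by j of (ad x_i)^m (x_j)
    is a multiple of x_i^m. *)
Lemma rder_ad j m f : j != i -> rder j (ad j m f) =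
  comb 1 (ad j m (rder j f)) (rder_coef j m) (iter m (L i) (twist (p j) f)).
Proof.
move=> ji; elim: m f => [|m IHm] f.
  by rewrite /= rder_shuf eqxx /rder_coef big_ord0.
apply: funext => w;
  rewrite /= (lin_rder j) rder_shuf !IHm rder_shuf [i == j]eq_sym (negPf ji).
rewrite lin_shuf lin_ad twist_shuf /rder_coef big_ord_recr /comb /=.
by rewrite (lin_scale _ _ _ (lin_iter m (lin_shuf p i))) -iterSr iterS; ring.
Qed.

(** The dual root vector: the braided commutators of right derivations that pair
    with (ad x_i)^m (x_j). *)
Fixpoint ad_rder j m : fn -> fn :=
  if m is m'.+1 then
    fun f => comb 1 (rder i (ad_rder j m' f)) (- (q ^+ m' * p j i))
      (ad_rder j m' (rder i f))
  else rder j.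

Lemma lin_ad_rder j m : lin (ad_rder j m).
Proof.
elim: m => // m IHm c f d g /=; rewrite !(lin_rder i) !IHm (lin_rder i).
by apply: funext => w; rewrite /comb; ring.
Qed.

Lemma ad_rder_lder j m k f : ad_rder j m (lder k f) = lder k (ad_rder j m f).
Proof.
elim: m f => // m IHm f /=; rewrite IHm.
by rewrite -[rder i (lder k f)]/(lder k (rder i f)) IHm.
Qed.

Lemma ad_rder_ad j m k n f : k != j -> j != i -> k != i ->
  ad_rder j m (ad k n f) = ad k n (ad_rder j m f).
Proof.
move=> kj ji ki; elim: m f => [|m IHm] f /=.
  by rewrite rder_ad_other // eq_sym.
by rewrite lin_ad IHm rder_ad_self // rder_ad_self // IHm.
Qed.

(** Each commutator with [rder i] removes one of the n factors x_i that
    [rder j] left behind.  At m = n only a scalar remains: the commutator of the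
    dual root vector with the root vector is a twist. *)
Lemma ad_rder_ad_self j m n f : j != i -> (m <= n)%N ->
  ad_rder j m (ad j n f) =
  comb 1 (ad j n (ad_rder j m f)) (rder_coef j n * \prod_(k < m) qint q (n - k))
     (iter (n - m) (L i) (twist (fun k => p i k ^+ m * p j k) f)).
Proof.
move=> ji; elim: m f => [|m IHm] f mn.
  rewrite /= rder_ad // big_ord0 mulr1 subn0; congr (comb _ _ _ (iter _ _ _)).
  by congr (twist _ _); apply: funext => k; rewrite mul1r.
apply: funext => w;
  rewrite /= IHm ?(ltnW mn) // rder_ad_self // IHm ?(ltnW mn) //.
rewrite (lin_rder i) rder_ad_self // rder_iter big_ord_recr /=.
have -> : (n - m).-1 = (n - m.+1)%N by rewrite subnS.
rewrite twist_twist rder_twist lin_ad.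
have -> : (fun k => p i k * (p i k ^+ m * p j k)) =
  (fun k => p i k ^+ m.+1 * p j k).
  by apply: funext => k; rewrite exprS mulrA.
rewrite /comb (lin_scale _ _ _ (lin_iter _ (lin_shuf p i))).
ring.
Qed.
End AdjointOperators.

(** * Reflection of a braiding at a letter *)

Section Reflect.
Variables (F : fieldType) (I : eqType) (i : I) (a : I -> nat).

(** With chi the bicharacter of p on the root lattice and s_i the reflection
    sending x_i to - x_i and x_k to x_k + a_k x_i, the entry (k, l) is the
    inverse of chi (s_i x_l, s_i x_k). *)
Definition reflected (p : I -> I -> F) (k l : I) : F :=
  if k == i then
    if l == i then (p i i)^-1 else p i i ^+ a l * p l i
  else if l == i then p i i ^+ a k * p i k
  else (p i k ^+ a l * p l k * (p i i ^+ a l * p l i) ^+ a k)^-1.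

Variable p : I -> I -> F.
Local Notation fn := (seq I -> F).
Implicit Types (f g h : fn) (u v w : seq I).
Local Notation q := (p i i).
Local Notation L := (shuf p).
Hypothesis p_neq0 : forall k l, p k l != 0.
Hypothesis p_cartan : forall k, k != i -> p i k * p k i * q ^+ a k = 1.
Hypothesis q_order : forall k m, k != i -> (0 < m <= a k)%N -> q ^+ m != 1.

(** The letters of the reflected braiding, realized as operators for p: the
    letter i, of degree - x_i, is the derivation by i. *)
Definition refl_op k : fn -> fn := if k == i then lder i else ad p i k (a k).

Lemma lin_refl_op k : lin (refl_op k).
Proof. by rewrite /refl_op; case: eqP => // _; exact: lin_ad. Qed.

(** The string of root vectors stops after a_k steps: the coefficient with which
    [lder i] lowers the next one is zero by the Cartan condition, so that all
    derivations annihilate it. *)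
Lemma serre k f : k != i -> ad p i k (a k).+1 f = fun=> 0.
Proof.
move=> ki; apply: zero_of_lder f => [f|l]; first exact: ad_nil.
have [->|li] := eqVneq l i.
  exists (q ^+ (a k).+1 * p k i) => f w.
  rewrite -[LHS]/(lder i (ad p i k (a k).+1 f) w) lder_ad_self // /lder_coef /=.
  have -> : 1 - q ^+ a k * (p i k * p k i) = 0 by
    rewrite mulrC p_cartan // subrr.
  by rewrite mulr0 {1}/comb mul0r add0r.
exists (p i l ^+ (a k).+1 * p k l) => f w.
by rewrite -[LHS]/(lder l (ad p i k (a k).+1 f) w) lder_ad // andbF {1}/comb
  mul0r add0r.
Qed.

Lemma shuf_ad k f : k != i ->
  L i (ad p i k (a k) f) = fun w => q ^+ a k * p i k * ad p i k (a k) (L i f) w.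
Proof.
move=> ki; apply: funext => w; have := congr1 (fun h => h w) (serre f ki).
by rewrite /= /comb mul1r mulNr => /eqP; rewrite subr_eq0 => /eqP.
Qed.

(** [refl_twist l] is the twist by the root x_l + a_l x_i, and [refl_norm l] the
    pairing of the root vector of that root with its dual. *)
Definition refl_twist l k := p i k ^+ a l * p l k.
Definition refl_norm l :=
  rder_coef p i l (a l) * \prod_(k < a l) qint q (a l - k).

Lemma refl_twist_neq0 l k : refl_twist l k != 0.
Proof. by rewrite mulf_neq0 ?expf_neq0. Qed.

(** Each factor can vanish only if q^j = 1 for some 0 < j <= a_l. *)
Lemma refl_norm_neq0 l : l != i -> refl_norm l != 0.
Proof.
move=> li; rewrite mulf_neq0 //; apply/prodf_neq0 => k _; last first.
  by apply: qint_neq0; apply: (q_order li); have := ltn_ord k; lia.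
have kl : (k <= a l)%N by apply: ltnW.
apply: contra_neq (q_order li (m := a l - k) _); last by have := ltn_ord k; lia.
move=> /subr0_eq h; apply: (mulfI (expf_neq0 k (p_neq0 i i))).
by rewrite -exprD subnKC // mulr1 -[RHS]mulr1 -(p_cartan li) mulrA -h mul1r.
Qed.

(** Operators that act on the [refl_op k] as derivations act on letters.  For
    the letter i the roles of x_i and of its derivation are exchanged.  For
    another letter the dual root vector is used; undoing the twist turns its
    right Leibniz rule into a left one, and the scalar normalizes the
    constant term to 1. *)
Definition refl_der l : fn -> fn :=
  if l == i then fun f w => - q * L i f w
  else fun f w => (refl_twist l i ^+ a l * refl_twist l l / refl_norm l) *
                  ad_rder p i l (a l) (twist (fun k => (refl_twist l k)^-1) f)
                    w.

Lemma lin_refl_der l : lin (refl_der l).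
Proof.
rewrite /refl_der => c f d g; case: eqP => _; apply: funext => w.
  by rewrite lin_shuf /comb; ring.
by rewrite lin_twist lin_ad_rder /comb; ring.
Qed.

(** The key relation: up to the change of braiding, [refl_op] and [refl_der]
    satisfy the relation [lder_shuf] between letters and derivations. *)
Lemma refl_der_op k l f :
  refl_der l (refl_op k f) =
    comb (k == l)%:R f (reflected p k l) (refl_op k (refl_der l f)).
Proof.
apply: funext => w; rewrite /refl_der /refl_op /reflected /comb.
case: (eqVneq l i) => [el|li]; case: (eqVneq k i) => [ek|ki];
  try subst l; try subst k; rewrite ?eqxx.
- rewrite (lin_scale _ _ _ (@lin_lder _ _ i)) lder_shuf eqxx /comb.
  by field; exact: p_neq0.
- rewrite shuf_ad // (lin_scale _ _ _ (lin_ad _ _ _ _)) (negPf ki) /=.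
  by ring.
- rewrite [i == l]eq_sym (negPf li) /=.
  rewrite (lin_scale _ _ _ (@lin_lder _ _ i)) -ad_rder_lder lder_twist.
  rewrite (lin_scale _ _ _ (lin_ad_rder _ _ _ _)) /refl_twist.
  have := p_neq0 i i; have := p_neq0 l i.
  set x := q ^+ _; have x0 : x != 0 by rewrite expf_neq0.
  move=> ? ?; have := refl_norm_neq0 li => ?.
  by field; rewrite ?x0; apply/and3P.
rewrite twist_ad (lin_scale _ _ _ (lin_ad_rder _ _ _ _))
  (lin_scale _ _ _ (lin_ad _ _ _ _)).
have E : (refl_twist l i)^-1 ^+ a k * (refl_twist l k)^-1 =
    (p i k ^+ a l * p l k * (q ^+ a l * p l i) ^+ a k)^-1.
  by rewrite /refl_twist !exprMn !invfM !exprMn !exprVn; ring.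
case: (eqVneq k l) => [ekl|kl]; last by rewrite ad_rder_ad // E /=; ring.
subst l; rewrite ad_rder_ad_self // subnn -/(refl_norm k) [iter 0 _ _]/=.
rewrite -/(refl_twist k) (twistVK _ (refl_twist_neq0 k)) -E /comb /=.
have := refl_norm_neq0 ki; have := refl_twist_neq0 k k;
  have := expf_neq0 (a k) (refl_twist_neq0 k i).
by rewrite exprVn => ? ? ?; field; apply/and3P.
Qed.

(** The polynomials that vanish on [refl_op] are stable under the derivations of
    the reflected braiding, because commuting with [refl_der] computes them. *)
Lemma reflect_poly_op_zero u P : homog u P ->
  (forall f, poly_op refl_op P f = fun=> 0) ->
  forall f, poly_op (shuf (reflected p)) P f = fun=> 0.
Proof.
apply: (zero_of_der_stable (N := fun P => forall f, poly_op refl_op P f =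
  fun=> 0)).
  move=> v Q j hQ NQ f; apply: funext => w.
  have := congr1 (fun h => h w) (leibniz lin_refl_op (lin_refl_der j)
    (refl_der_op ^~ j) f hQ).
  by rewrite /= !NQ (lin0 (lin_refl_der j)) /comb mul1r mulr0 addr0.
move=> Q hQ NQ; apply: etrans (congr1 (fun h => h [::]) (NQ (@unit_fn F I))).
by apply: eq_big_seq => t /(allP hQ) /perm_nilP-> /=; rewrite /unit_fn mulr1.
Qed.

Lemma reflect_word_op_zero u : (forall f, word_op refl_op u f = fun=> 0) ->
  forall f, word_op (shuf (reflected p)) u f = fun=> 0.
Proof.
have E X f : word_op X u f = poly_op X [:: (1, u)] f :> fn.
  by apply: funext => w; rewrite /poly_op big_seq1 mul1r.
move=> h f; rewrite E; apply: (@reflect_poly_op_zero u) => [|g].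
  by rewrite /homog /= perm_refl.
by rewrite -E.
Qed.

Inductive spanned (G : (fn -> fn) -> Prop) : (fn -> fn) -> Prop :=
| spanned0 : spanned G (fun _ _ => 0)
| spannedS c A B : G A -> spanned G B ->
  spanned G (fun f => comb c (A f) 1 (B f)).

Lemma spanned_zero (G : (fn -> fn) -> Prop) A : spanned G A ->
  (forall B, G B -> forall f, B f = fun=> 0) -> forall f, A f = fun=> 0.
Proof.
move=> hA hG f; elim: hA => // c B C /hG hB _ hC.
by rewrite hB hC; apply: funext => w; rewrite /comb !mulr0 addr0.
Qed.

Lemma spanned_mem (G : (fn -> fn) -> Prop) A : G A -> spanned G A.
Proof.
move=> hA; have -> : A = (fun f => comb 1 (A f) 1 (fun=> 0)).
  by apply: funext => f; apply: funext => w; rewrite /comb mul1r mulr0 addr0.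
exact: spannedS hA (spanned0 G).
Qed.

Lemma spanned_comb (G : (fn -> fn) -> Prop) c A d B : spanned G A ->
  spanned G B ->
  spanned G (fun f => comb c (A f) d (B f)).
Proof.
have scale e C : spanned G C -> spanned G (fun f w => e * C f w).
  elim=> [|e' C1 C2 hC1 _ IH].
    have -> : (fun (_ : fn) (_ : seq I) => e * 0) = (fun _ _ => 0).
      by apply: funext => f; apply: funext => w; rewrite mulr0.
    exact: spanned0.
  have -> : (fun f w => e * comb e' (C1 f) 1 (C2 f) w) =
      (fun f => comb (e * e') (C1 f) 1 ((fun f w => e * C2 f w) f)).
    by apply: funext => f; apply: funext => w; rewrite /comb; ring.
  exact: spannedS.
move=> hA /(scale d) hB; elim: hA => [|e C1 C2 hC1 _ IH].
  have -> // : (fun f => comb c (fun=> 0) d (B f)) = (fun f w => d * B f w).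
  by apply: funext => f; apply: funext => w; rewrite /comb mulr0 add0r.
have -> : (fun f => comb c (comb e (C1 f) 1 (C2 f)) d (B f)) =
    (fun f => comb (c * e) (C1 f) 1 ((fun f => comb c (C2 f) d (B f)) f)).
  by apply: funext => f; apply: funext => w; rewrite /comb; ring.
exact: spannedS.
Qed.

Lemma spanned_comp (G G' : (fn -> fn) -> Prop) T A : lin T -> spanned G A ->
  (forall B, G B -> spanned G' (T \o B)) -> spanned G' (T \o A).
Proof.
move=> hT hA hG; elim: hA => [|c B C hB _ IH].
  have -> : T \o (fun (_ : fn) (_ : seq I) => 0) = (fun _ _ => 0).
    by apply: funext => f /=; rewrite lin0.
  exact: spanned0.
have -> : T \o (fun f => comb c (B f) 1 (C f)) =
   (fun f => comb c ((T \o B) f) 1 ((T \o C) f)).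
  by apply: funext => f /=; rewrite hT.
by apply: spanned_comb => //; exact: hG.
Qed.

Lemma spanned_sub (G G' : (fn -> fn) -> Prop) A : spanned G A ->
  (forall B, G B -> G' B) -> spanned G' A.
Proof.
by move=> hA hG; elim: hA => [|c B C hB _ IH];
  [exact: spanned0|apply: spannedS => //; exact: hG].
Qed.

Lemma ad_spanned k m v T : spanned
  (fun A => exists2 v', perm_eq v' (nseq m i ++ k :: v) & A = word_op L v' \o T)
  (fun f => ad p i k m (word_op L v (T f))).
Proof.
elim: m v => [|m IHm] v; first by apply: spanned_mem; exists (k :: v).
apply: (@spanned_comb _ 1 _ _ (fun f => ad p i k m (L i (word_op L v (T f))))).
  apply: (spanned_comp (lin_shuf p i) (IHm v)) => _ [v' hv' ->].
  by apply: spanned_mem; exists (i :: v'); rewrite //= perm_cons.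
apply: (spanned_sub (IHm (i :: v))) => _ [v' hv' ->]; exists v' => //.
apply: (perm_trans hv').
by apply/seq.permP => x; rewrite !count_cat /= ; lia.
Qed.

Lemma poly_op_spanned P T : spanned
  (fun A => exists2 t, t \in P & A = word_op L t.2 \o T)
  (fun f => poly_op L P (T f)).
Proof.
elim: P => [|t P IHP].
  have -> : (fun f => poly_op L [::] (T f)) = (fun _ _ => 0).
    by apply: funext => f; apply: funext => w; rewrite /poly_op big_nil.
  exact: spanned0.
have -> : (fun f => poly_op L (t :: P) (T f)) =
    (fun f => comb t.1 ((word_op L t.2 \o T) f) 1 (poly_op L P (T f))).
  by apply: funext => f; apply: funext => w;
    rewrite /poly_op big_cons /comb mul1r.
apply: spannedS; first by exists t; rewrite ?mem_head.
by apply: spanned_sub IHP _ => B [t' ht' ->]; exists t';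
  rewrite // inE ht' orbT.
Qed.

(** The number of letters i brought in by reflecting the others. *)
Definition refl_weight u := (\sum_(k <- u | k != i) a k)%N.

(** Moving derivations to the right writes a word in the reflected letters as a
    combination of ordinary words followed by derivations.  The letters other
    than i keep their number; the degree in x_i is the reflected one, plus the
    number t of derivations that were not absorbed. *)
Lemma refl_op_spanned u : spanned (fun A => exists w t,
    [/\ A = word_op L w \o iter t (lder i),
        count (predC1 i) w = count (predC1 i) u &
        count_mem i w + count_mem i u =
          refl_weight u + t]%N) (word_op refl_op u).
Proof.
elim: u => [|k u IHu].
  by apply: spanned_mem; exists [::], 0%N; rewrite /refl_weight big_nil.
rewrite -[word_op refl_op (k :: u)]/(refl_op k \o word_op refl_op u).
apply: (spanned_comp (lin_refl_op k) IHu) => _ [w [t [-> hw1 hw2]]].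
rewrite /refl_op /refl_weight big_cons /=; case: (eqVneq k i) => [ki|ki] /=.
  have -> : lder i \o (word_op L w \o iter t (lder i)) = (fun f =>
    comb 1 (poly_op L (der_word p i w) (iter t (lder i) f)) (chi p i w)
      ((word_op L w \o iter t.+1 (lder i)) f)).
    apply: funext => f.
    exact: (leibniz_word (lin_shuf p) (lder_shuf p ^~ i) w (iter t (lder i) f)).
  apply: spanned_comb; last first.
    by apply: spanned_mem; exists w, t.+1; split=> //; move: hw2;
      rewrite /refl_weight; lia.
  apply: (spanned_sub (poly_op_spanned _ _)) => _
    [t' /der_word_perm/seq.permP ht' ->].
  exists t'.2, t; split=> //.
    by have := ht' (predC1 i); rewrite /= eqxx /= add0n => <-.
  by have := ht' (pred1 i); move: hw2; rewrite /= eqxx /refl_weight; lia.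
apply: (spanned_sub (ad_spanned _ _ _ _)) => _ [v' /seq.permP hv' ->].
exists v', t; split=> //.
  by rewrite hv' count_cat count_nseq /= eqxx ki hw1; lia.
by rewrite hv' count_cat count_nseq /= eqxx (negPf ki); move: hw2;
  rewrite /refl_weight; lia.
Qed.

(** A nonzero word u of the reflected braiding yields a nonzero word of p, with
    as many letters other than i and at least [refl_weight u - count_mem i u]
    letters i. *)
Lemma reflect_zero u :
  (forall w, count (predC1 i) w = count (predC1 i) u ->
    (refl_weight u <= count_mem i w + count_mem i u)%N ->
    forall f, word_op L w f = fun=> 0) ->
  forall f, word_op (shuf (reflected p)) u f = fun=> 0.
Proof.
move=> H; apply: reflect_word_op_zero;
  apply: (spanned_zero (refl_op_spanned u)).
by move=> _ [w [t [-> h1 h2]]] f /=; rewrite H // h2 leq_addr.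
Qed.
End Reflect.

(** * Braidings of Cartan type with nonpositive row sums *)

Section Bounded.
Variables (F : fieldType) (I : eqType).
Local Notation fn := (seq I -> F).
Implicit Types (p : I -> I -> F).

Lemma lder_iter p k i n f : lder k (iter n (shuf p i) f) =
  comb (if i == k then qint (p i i) n else 0) (iter n.-1 (shuf p i) f)
       (p i k ^+ n) (iter n (shuf p i) (lder k f)).
Proof.
elim: n f => [|n IHn] f; apply: funext => w.
  by rewrite qint0 if_same /comb /=; ring.
rewrite iterS lder_shuf IHn lin_shuf /comb exprS.
case: (eqVneq i k) => [<-|ik] /=; last by ring.
by rewrite qintSl; case: n {IHn} => [|n] /=; rewrite ?qint0; ring.
Qed.

Lemma shuf_nilpotent p i M f : M.-primitive_root (p i i) -> (1 < M)%N ->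
  iter M (shuf p i) f = fun=> 0.
Proof.
move=> qM M1; have q0 : qint (p i i) M = 0.
  have q1 : p i i != 1 by rewrite -(expr1 (p i i)) -(prim_order_dvd qM) gtnNdvd.
  apply: (mulfI (x := p i i - 1)); first by rewrite subr_eq0.
  by rewrite mulr0 -subrX1 prim_expr_order // subrr.
apply: zero_of_lder f => [f|k].
  by case: M M1 {qM q0}.
exists (p i k ^+ M) => f w;
  rewrite -[LHS]/(lder k (iter M (shuf p i) f) w) lder_iter q0.
by rewrite if_same /comb mul0r add0r.
Qed.

Definition bounded p :=
  exists N, forall u, (N < size u)%N -> forall f, word_op (shuf p) u f =
    fun=> 0.

Lemma word_op_nseq (X : I -> fn -> fn) i n f : word_op X (nseq n i) f =
  iter n (X i) f.
Proof. by elim: n => //= n ->. Qed.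

(** A nonzero word has at most M - 1 equal letters in a row, since x_i^M = 0; so
    the number of its letters i is bounded in terms of the others.  The prefix
    counts the run being read. *)
Lemma long_run p i M r v f : M.-primitive_root (p i i) -> (1 < M)%N ->
  (M.-1 * (count (predC1 i) v).+1 < r + count_mem i v)%N ->
  word_op (shuf p) (nseq r i ++ v) f = fun=> 0.
Proof.
move=> qM M1;
  have run n g : (M <= n)%N -> word_op (shuf p) (nseq n i) g = fun=> 0.
  by move=> Mn; rewrite word_op_nseq -(subnKC Mn) iterD shuf_nilpotent.
elim: v r => [|k v IHv] r; first by rewrite cats0 /= => h; apply: run; lia.
rewrite /=; case: (eqVneq k i) => [->|ki] /= h.
  have -> : nseq r i ++ i :: v = nseq r.+1 i ++ v by elim: (r) => //= r' ->.
  by apply: IHv; move: h; lia.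
case: (leqP M r) => [Mr|rM]; first by rewrite word_op_cat run.
rewrite word_op_cat /= -[v]/(nseq 0 i ++ v) IHv; last by move: h;
  rewrite mulnS; lia.
by rewrite (lin0 (lin_shuf p k)) (lin0 (lin_word_op _ (lin_shuf p))).
Qed.
End Bounded.

Section Cartan.
Variables (F : fieldType) (I : finType) (M : nat) (A : I -> I -> nat).
Implicit Types (p : I -> I -> F) (w : F).

(** A braiding of Cartan type with symmetric Cartan matrix 2 on the diagonal and
    - A k l off it.  The entries are roots of unity of order dividing M, which
    makes the set of such braidings finite. *)
Record cartan w p : Prop := {
  cartan_prim : M.-primitive_root w;
  cartan_diag : forall k, p k k = w;
  cartan_root : forall k l, p k l ^+ M = 1;
  cartan_edge : forall k l, k != l -> p k l * p l k * w ^+ A k l = 1 }.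

Hypothesis A_sym : forall k l, A k l = A l k.
Hypothesis A_lt : forall k l, k != l -> (A k l < M)%N.

Lemma cartan_neq0 w p k l : cartan w p -> p k l != 0.
Proof.
move=> [hw _ hr _]; apply: contra_eq_neq (hr k l) => ->.
by rewrite expr0n gtn_eqF ?(prim_order_gt0 hw) // eq_sym oner_eq0.
Qed.

(** Reflections are involutions, so that nonzero words can be transported from
    a braiding to its reflection as well as back. *)
Lemma reflectedK w p i : cartan w p -> reflected i (A i) (reflected i (A i) p) =
  p.
Proof.
move=> hp; have p0 k l := cartan_neq0 k l hp.
apply: funext => k; apply: funext => l; rewrite /reflected !eqxx.
have x0 n : p i i ^+ n != 0 by rewrite expf_neq0.
case: (eqVneq k i) => [ek|ki]; case: (eqVneq l i) => [el|li]; try subst k;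
  try subst l;
  rewrite ?invrK // ?eqxx.
- by rewrite exprVn mulKf.
- by rewrite exprVn mulKf.
rewrite exprVn mulKf // !exprMn -!exprM.
have y0 : p i l ^+ A i k != 0 by rewrite expf_neq0.
have z0 : p k i ^+ A i l != 0 by rewrite expf_neq0.
move: (x0 (A i k * A i l)%N) y0 z0 (p0 k l).
move: (p i i ^+ _) (p i l ^+ _) (p k i ^+ _) (p k l) => x y z t hx hy hz ht.
by field; rewrite hx hy hz ht oner_neq0.
Qed.

(** The symmetrized bicharacter is a power of w determined by the invariant form
    of the Cartan matrix, and reflections preserve that form. *)
Lemma cartan_reflected w p i : cartan w p -> cartan w^-1 (reflected i (A i) p).
Proof.
move=> hp; have p0 k l := cartan_neq0 k l hp.
case: (hp) => hw hd hr he.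
have M0 := prim_order_gt0 hw.
have E k l : k != i -> l != i ->
  reflected i (A i) p k l * reflected i (A i) p l k = (p k l * p l k)^-1.
  move=> ki li; rewrite /reflected (negPf ki) (negPf li) hd !exprMn -invfM.
  congr (_^-1).
  have h1 := he i k; have h2 := he i l; rewrite eq_sym in h1;
    rewrite eq_sym in h2.
  have := congr1 (fun x => x ^+ A i l) (h1 ki).
  have := congr1 (fun x => x ^+ A i k) (h2 li).
  rewrite !expr1n !exprMn -!exprM [(A i l * A i k)%N]mulnC.
  move: (w ^+ _) (p i k ^+ _) (p k i ^+ _) (p i l ^+ _) (p l i ^+ _) => x y z t
    s h3 h4.
  transitivity (p k l * p l k * (y * z * x) * (t * s * x)); first by ring.
  by rewrite h4 h3 !mulr1.
have wV : w^-1 = w ^+ M.-1.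
  apply: (mulfI (x := w)); first by rewrite -(hd i).
  by rewrite -exprS prednK // prim_expr_order // mulfV // -(hd i).
split.
- by rewrite wV (prim_root_exp_coprime _ hw) coprime_sym coprimenP.
- move=> k; case: (eqVneq k i) => [->|ki]; first by rewrite /reflected eqxx hd.
  rewrite /reflected (negPf ki) !hd; congr (_^-1); rewrite mulrAC -exprMn.
  have -> : p i k * (w ^+ A i k * p k i) = 1 by
    rewrite mulrCA mulrC he // eq_sym.
  by rewrite expr1n mul1r.
- have hV x n : x ^+ M = 1 :> F -> (x ^+ n) ^+ M = 1 by
  rewrite -exprM mulnC exprM => ->; rewrite expr1n.
  move=> k l; rewrite /reflected.
  case: eqP => _; case: eqP => _;
    rewrite ?exprVn ?exprMn ?hV ?hr ?mulr1 ?invr1 //.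
move=> k l kl; case: (eqVneq k i) => [ek|ki].
  subst k; rewrite /reflected eqxx eq_sym (negPf kl) hd exprVn.
  rewrite -[RHS](he _ _ kl);
    have x0 : w ^+ A i l != 0 by rewrite expf_neq0 // -(hd i).
  by field.
case: (eqVneq l i) => [el|li].
  subst l; rewrite /reflected eqxx (negPf kl) hd exprVn [A k i]A_sym.
  rewrite -[RHS](he _ _ kl) [A k i]A_sym.
  have x0 : w ^+ A i k != 0 by rewrite expf_neq0 // -(hd i).
  by field.
by rewrite E // exprVn -invfM he // invr1.
Qed.

Lemma refl_weightE i u :
  refl_weight i (A i) u = (\sum_(k | k != i) A i k * count_mem k u)%N.
Proof.
elim: u => [|l u IHu].
  by rewrite /refl_weight big_nil big1 // => k _; rewrite muln0.
rewrite /refl_weight big_cons -/(refl_weight i (A i) u) IHu /=.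
under [RHS]eq_bigr do rewrite mulnDr.
rewrite big_split /=; case: (eqVneq l i) => [->|li] /=.
  by rewrite [X in _ = (X + _)%N]big1 // => k ki;
    rewrite eq_sym (negPf ki) muln0.
rewrite [X in _ = (X + _)%N](bigD1 l) //= eqxx muln1 [X in _ =
  (_ + X + _)%N]big1 ?addn0 //.
by move=> k /andP[_ kl]; rewrite eq_sym (negPf kl) muln0.
Qed.

Lemma cartan_reflect_zero w p i u : cartan w p ->
  (forall v, count (predC1 i) v = count (predC1 i) u ->
    (refl_weight i (A i) u <= count_mem i v + count_mem i u)%N ->
    forall f, word_op (shuf p) v f = fun=> 0) ->
  forall f, word_op (shuf (reflected i (A i) p)) u f = fun=> 0.
Proof.
move=> hp; case: (hp) => hw hd hr he;
  apply: reflect_zero => [k l|k ki|k m ki /andP[m0 ma]].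
- exact: cartan_neq0 hp.
- by rewrite hd he // eq_sym.
rewrite hd -(prim_order_dvd hw) gtnNdvd //.
by apply: leq_ltn_trans ma (A_lt _); rewrite eq_sym.
Qed.

Hypothesis M_gt1 : (1 < M)%N.

(** Reflection keeps the number of letters other than i, and [long_run] bounds
    the letters i. *)
Lemma bounded_reflected w p i : cartan w p -> bounded p ->
  bounded (reflected i (A i) p).
Proof.
move=> hp [N hN]; exists (N + M.-1 * N.+1)%N => u hu.
have h := count_predC (pred1 i) u.
have hc : count (predC1 i) u = count (predC (pred1 i)) u by [].
case: (leqP (count (predC1 i) u) N) => hn.
  move=> f; rewrite -[u]/(nseq 0 i ++ u); apply: (@long_run _ _ _ _ M) => //.
    by case: (cartan_reflected i hp) => hw hd _ _; rewrite hd.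
  have : (M.-1 * (count (predC1 i) u).+1 <= M.-1 * N.+1)%N by
    rewrite leq_mul2l ltnS hn orbT.
  by lia.
apply: (cartan_reflect_zero hp) => v hv _; apply: hN.
by apply: leq_trans hn _; rewrite -hv count_size.
Qed.

Hypothesis A_ge2 : forall k, (2 <= \sum_(l | l != k) A k l)%N.
Variable k0 : I.

(** If u were nonzero and of maximal length, with i its least frequent letter,
    then multiplication by x_i would kill it, so its derivative by i would be
    nonzero.  That derivative has one letter i less, and reflecting it gives at
    least 2 n - (n - 1) > n letters i, where n is their number in u: a nonzero
    word longer than u. *)
Lemma vanishing_descent m :
  (forall w p u, cartan w p -> bounded p -> (m < size u)%N ->
     forall f, word_op (shuf p) u f = fun=> 0) ->
  forall w p u, cartan w p -> bounded p -> size u = m ->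
     forall f, word_op (shuf p) u f = fun=> 0.
Proof.
move=> H w p u hp bp um f.
case: (@arg_minnP I k0 predT (fun k => count_mem k u) isT) => i _ mini.
have Lu0 g : shuf p i (word_op (shuf p) u g) = fun=> 0.
  by apply: (H w p (i :: u)) => //=; rewrite um.
have dP g : poly_op (shuf p) (der_word p i u) g = fun=> 0.
  apply: funext => x;
    rewrite /poly_op big1_seq // => t /andP[_ /der_word_perm/seq.permP ht].
  rewrite -(reflectedK i hp) (cartan_reflect_zero (cartan_reflected i hp))
    ?mulr0 // => v hv1 hv2.
  apply: (H _ _ _ (cartan_reflected i hp) (bounded_reflected i hp bp)).
  have wt : (2 * count_mem i t.2 + 2 <= refl_weight i (A i) t.2)%N.
    rewrite refl_weightE; have hti := ht (pred1 i); rewrite /= eqxx in hti.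
    apply: (@leq_trans (\sum_(k | k != i) A i k * count_mem i u)).
      by rewrite -big_distrl /= hti; have := A_ge2 i; nia.
    apply: leq_sum => k ki; rewrite leq_mul2l; have := ht (pred1 k).
    by rewrite /= eq_sym (negPf ki) add0n => <-; rewrite mini ?orbT.
  have -> : m = (size t.2).+1 by
    rewrite -um -[size u]count_predT (ht predT) /= count_predT.
  have aux a b c d n : (2 * a + 2 <= d)%N -> (d <= b + a)%N -> c = n ->
    ((a + n).+1 < b + c)%N by lia.
  have hs y : size y = (count_mem i y + count (predC1 i) y)%N by
    rewrite -(count_predC (pred1 i)).
  by rewrite !hs; apply: aux wt hv2 hv1.
have E := leibniz_word (lin_shuf p) (lder_shuf p ^~ i) u f.
have := congr1 (lder i) (Lu0 f); rewrite lder_shuf eqxx E dP.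
rewrite (lin_shuf p) (Lu0 (lder i f)) (lin0 (lin_shuf p i)) => h.
apply: funext => x; have := congr1 (fun g => g x) h.
by rewrite /comb /lder /= !mul1r !mulr0 !addr0 ?mulr0 ?addr0.
Qed.

(** A common bound on the lengths of the nonzero words of all bounded braidings
    would, by [vanishing_descent], decrease to 0, although the empty word is
    nonzero. *)
Lemma cartan_unbounded w p : cartan w p -> ~ bounded p.
Proof.
move=> hp bp.
(* A common bound exists because the braidings are given by tables of exponents
   of one primitive root, of which there are finitely many. *)
have [N hN] : exists N, forall w p u, cartan w p -> bounded p ->
  (N < size u)%N ->
    forall f, word_op (shuf p) u f = fun=> 0.
  case: (hp) => hw _ _ _.
  pose pe (e : {ffun I * I -> 'I_M}) k l := w ^+ e (k, l).
  have [B hB] : exists B : {ffun I * I -> 'I_M} -> nat, forall e,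
    bounded (pe e) ->
      forall u, (B e < size u)%N -> forall f, word_op (shuf (pe e)) u f =
        fun=> 0.
    apply: (fin_all_exists (P := fun e Ne => bounded (pe e) ->
      forall u, (Ne < size u)%N -> forall f, word_op (shuf (pe e)) u f =
        fun=> 0)) => e.
    have [[N hN]|nb] := EM (bounded (pe e)).
      by exists N.
    by exists 0%N.
  exists (\max_e B e)%N => w' p' u hp' bp' hu.
  have he kl : exists e : 'I_M, p' kl.1 kl.2 = w ^+ e.
    by have [e he] := prim_rootP hw (cartan_root hp' kl.1 kl.2); exists e.
  have [e0 he0] := fin_all_exists he.
  pose e := [ffun kl => e0 kl].
  have Ep : p' = pe e.
    by apply: funext => k; apply: funext => l; rewrite /pe ffunE -he0.
  rewrite Ep; apply: hB; first by rewrite -Ep.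
  by apply: leq_ltn_trans hu; apply: leq_bigmax.
have H m : forall w p u, cartan w p -> bounded p -> (N - m < size u)%N ->
    forall f, word_op (shuf p) u f = fun=> 0.
  elim: m => [|m IHm]; first by rewrite subn0.
  move=> w' p' u hp' bp' hu; case: (ltnP (N - m) (size u)) => h.
    by apply: IHm hp' bp' h.
  by apply: (vanishing_descent IHm hp' bp'); move: h hu; lia.
have H0 := vanishing_descent (H N).
have := H0 w p [::] hp bp; rewrite subnn => /(_ erefl (@unit_fn F I)).
move/(congr1 (fun h => h [::])) => /eqP; rewrite /= /unit_fn oner_eq0 //.
Qed.

Theorem cartan_infinite w p N : cartan w p ->
  ~ (forall u, (N < size u)%N -> word_op (shuf p) u (@unit_fn F I) = fun=> 0).
Proof.
move=> hp h; apply: (cartan_unbounded hp); exists N => u hu.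
by apply: word_op_unit_fn; apply: h.
Qed.
End Cartan.

(** * From the tensor algebra to the shuffle operators *)

Lemma scale_malgU (K : fieldType) (G : choiceType) (c d : K) (k : G) :
  c *: << d *g k >> = << c * d *g k >> :> {malg K[G]}.
Proof. by apply/malgP => l; rewrite mcoeffZ !mcoeffU -mulrnAr. Qed.

Section Ext.
Variables (K : fieldType) (G : choiceType) (V : lmodType K).
Implicit Types (h : G -> V) (a b : {malg K[G]}).

Definition ext h a : V := \sum_(k <- msupp a) a@_k *: h k.

Lemma extEw h a (d : {fset G}) : (msupp a `<=` d)%fset ->
  ext h a = \sum_(k <- d) a@_k *: h k.
Proof.
move=> le; rewrite /ext (big_fset_incl _ le) // => k _ /mcoeff_outdom->.
by rewrite scale0r.
Qed.

Lemma ext_is_linear h : linear (ext h).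
Proof.
move=> c a b; pose d := (msupp (c *: a + b) `|` (msupp a `|` msupp b))%fset.
rewrite (@extEw h _ d) ?fsubsetUl // (@extEw h a d); last first.
  by apply: fsubset_trans (fsubsetUr _ _); apply: fsubsetUl.
rewrite (@extEw h b d); last first.
  by apply: fsubset_trans (fsubsetUr _ _); apply: fsubsetUr.
rewrite scaler_sumr -big_split /=; apply: eq_bigr => k _.
by rewrite mcoeffD mcoeffZ scalerDl scalerA.
Qed.

HB.instance Definition _ h :=
  GRing.isLinear.Build K {malg K[G]} V _ (ext h) (ext_is_linear h).

Lemma extU h c k : ext h << c *g k >> = c *: h k.
Proof.
rewrite (@extEw h _ [fset k]%fset) ?msuppU_le // big_seq_fset1.
by rewrite mcoeffUU.
Qed.

Lemma extD h a b : ext h (a + b) = ext h a + ext h b.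
Proof. exact: linearD. Qed.

Lemma ext1 h k : ext h << k >> = h k.
Proof. by rewrite extU scale1r. Qed.

Lemma eq_ext h1 h2 a : h1 =1 h2 -> ext h1 a = ext h2 a.
Proof. by move=> e; apply: eq_bigr => k _; rewrite e. Qed.
End Ext.

Lemma ext_comp (K : fieldType) (G : choiceType) (V W : lmodType K)
    (f : {linear V -> W}) (h : G -> V) a : f (ext h a) = ext (f \o h) a.
Proof. by rewrite /ext linear_sum; apply: eq_bigr => k _; rewrite linearZ. Qed.

Lemma ext_scale (K : fieldType) (G : choiceType) (V : lmodType K) c (h : G ->
  V) a :
  c *: ext h a = ext (fun k => c *: h k) a.
Proof.
by rewrite /ext scaler_sumr; apply: eq_bigr => k _; rewrite !scalerA mulrC.
Qed.

Lemma ext_id (K : fieldType) (G : choiceType) (a : {malg K[G]}) :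
  ext (fun k => << k >>) a = a.
Proof.
by rewrite [RHS]monalgE; apply: eq_bigr => k _; rewrite scale_malgU mulr1.
Qed.

Lemma ext_coeff (K : fieldType) (G : choiceType) (V : lmodType K) m (b : V)
    (a : {malg K[G]}) : ext (fun k => (k == m)%:R *: b) a = a@_m *: b.
Proof.
rewrite /ext; have [ma|ma] := boolP (m \in msupp a).
  rewrite (big_fsetD1 m) //= eqxx scale1r big_seq_cond big1 ?addr0 // => k.
  by rewrite !inE andbT => /andP[/negPf-> _]; rewrite scale0r scaler0.
rewrite (mcoeff_outdom ma) scale0r big_seq_cond big1 // => k /andP[ka _].
case: eqP => [e|_]; last by rewrite scale0r scaler0.
by rewrite -e ka in ma.
Qed.

Lemma malg_mulrZ (K : fieldType) (G : monomType) (x y : {malg K[G]}) c :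
  x * (c *: y) = c *: (x * y).
Proof.
apply/malgP => k;
  rewrite mcoeffZ (mcoeffMlw _ (fsubset_refl _) (msuppZ_le c y)) mcoeffMl
    mulr_sumr.
apply: eq_bigr => k1 _; rewrite mulr_sumr; apply: eq_bigr => k2 _.
by rewrite mcoeffZ mulrCA mulrnAr.
Qed.

Lemma ext_mulr (K : fieldType) (G : choiceType) (H : monomType)
    (x : {malg K[H]}) (h : G -> {malg K[H]}) a :
  ext (fun k => x * h k) a = x * ext h a.
Proof.
by rewrite /ext mulr_sumr; apply: eq_bigr => k _; rewrite malg_mulrZ.
Qed.

Lemma ext0 (K : fieldType) (G : choiceType) (V : lmodType K) (h : G -> V) a :
  (forall k, h k = 0) -> ext h a = 0.
Proof. by move=> h0; rewrite /ext big1 // => k _; rewrite h0 scaler0. Qed.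

Section Nichols.
Variables (K : fieldType) (gT : finGroupType) (M : yd_data K gT).
Local Notation X := (yd_basis M).
Local Notation word := {fmonom X}.
Local Notation T := {malg K[word]}.
Local Notation TT := {malg K[(word * word)%type]}.

(** Contraction of the first tensor factor with the coordinate of the word m. *)
Definition part (m : word) : TT -> T :=
  ext (fun q : word * word => if q.1 == m then << q.2 >> else 0 : T).

Lemma part_is_linear m : linear (part m).
Proof. exact: ext_is_linear. Qed.

HB.instance Definition _ m :=
  GRing.isLinear.Build K TT T _ (part m) (part_is_linear m).

Lemma partD m A B : part m (A + B) = part m A + part m B.
Proof. exact: linearD. Qed.

Lemma part0 m : part m 0 = 0.
Proof. exact: linear0. Qed.

Lemma tensE (a b : T) :
  tens a b = ext (fun u => ext (fun v => << (u, v) >> : TT) b) a.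
Proof.
rewrite /tens /ext; apply: eq_bigr => u _; rewrite scaler_sumr.
by apply: eq_bigr => v _; rewrite scalerA scale_malgU mulr1.
Qed.

Lemma part_tens m (a b : T) : part m (tens a b) = a@_m *: b.
Proof.
rewrite tensE ext_comp -ext_coeff; apply: eq_ext => u /=.
rewrite ext_comp -[in RHS](ext_id b) ext_scale; apply: eq_ext => v /=.
by rewrite /part extU scale1r /=; case: eqP => _; rewrite ?scale0r ?scale1r.
Qed.

Definition bmul (p q : word * word) : TT :=
  tens (<< p.1 >> * @wact K gT M (wdeg p.2) q.1) (<< p.2 >> * << q.2 >>).

Lemma braided_mulE A B :
  @braided_mul K gT M A B = ext (fun p => ext (bmul p) B) A.
Proof.
rewrite /braided_mul /ext; apply: eq_bigr => p _; rewrite scaler_sumr.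
by apply: eq_bigr => q _; rewrite scalerA.
Qed.

Lemma comulE a : comul a = ext (@wcomul K gT M) a.
Proof. by []. Qed.

Lemma tensU (u v : word) : tens (<< u >> : T) << v >> = << (u, v) >>.
Proof. by rewrite tensE !extU !scale1r. Qed.

Lemma braided_mul_gen x B :
  @braided_mul K gT M (tens (gen x) 1 + tens 1 (gen x)) B =
  ext (bmul (fmu x, mone)) B + ext (bmul (mone, fmu x)) B.
Proof.
rewrite braided_mulE.
rewrite (extD (fun p => ext (bmul p) B) (tens (gen x) 1) (tens 1 (gen x))).
apply: (congr2 +%R).
  exact: etrans (congr1 _ (tensU _ _)) (ext1 _ _).
exact: etrans (congr1 _ (tensU _ _)) (ext1 _ _).
Qed.

Lemma wcomul_cons x (w : seq X) : wcomul (FMonom (x :: w)) =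
  ext (bmul (fmu x, mone)) (wcomul (FMonom w)) +
  ext (bmul (mone, fmu x)) (wcomul (FMonom w)).
Proof. exact: braided_mul_gen. Qed.

Lemma mcoeff_genM x (a : T) m : (<< fmu x >> * a)@_m =
  (if fmonom_val m is y :: m' then (x == y)%:R * a@_(FMonom m') else 0).
Proof.
rewrite malgM_def fgmulUg raddf_sum /= [in RHS](monalgE a).
case: m => [[|y m]] /=.
  by rewrite big1 // => k _;
    rewrite mcoeffU -[mmul _ _]/(fmmul _ _) fmmulE fmuE.
rewrite raddf_sum mulr_sumr /=; apply: eq_bigr => k _.
rewrite !mcoeffU mul1r mulrnAr mulr_natl -mulrnA mulnb -[mmul _ _]/(fmmul _ _)
  fmmulE fmuE.
by rewrite fmP [k == _]fmP /= eqseq_cons andbC.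
Qed.

Lemma malgUM (u v : word) : << u >> * << v >> = << mmul u v >> :> T.
Proof. by rewrite malgM_def fgmulUU mulr1. Qed.

Lemma gen_word x (w : seq X) :
  << fmu x >> * << FMonom w >> = << FMonom (x :: w) >> :> T.
Proof. by rewrite malgUM -[mmul _ _]/(fmmul _ _) fmmulE fmuE. Qed.

Definition act_letter h x : T := \sum_(y : X) yd_act h x y *: gen y.

Lemma mcoeff_act_letterM h x (a : T) m : (act_letter h x * a)@_m =
  (if fmonom_val m is y :: m' then yd_act h x y * a@_(FMonom m') else 0).
Proof.
rewrite mulr_suml raddf_sum /=.
under eq_bigr do rewrite -scalerAl mcoeffZ mcoeff_genM.
case: (fmonom_val m) => [|y m']; first by rewrite big1 // => y _; rewrite mulr0.
rewrite (bigD1 y) //= eqxx mul1r big1 ?addr0 // => z /negPf->.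
by rewrite mul0r mulr0.
Qed.

Lemma wact_cons h (x : X) (w : seq X) :
  @wact K gT M h (FMonom (x :: w)) = act_letter h x * @wact K gT M h (FMonom w).
Proof. by rewrite /wact big_cons. Qed.

Lemma mcoeff1E (m : word) : (1 : T)@_m = (fmonom_val m == [::])%:R.
Proof. by rewrite mcoeff1 fmP -[mone]/(fmone _) fmoneE. Qed.

Lemma wact_nil h (w : word) :
  (@wact K gT M h w)@_(FMonom [::]) = (fmonom_val w == [::])%:R.
Proof.
case: w => [[|x w]]; first by rewrite /wact big_nil mcoeff1E.
by rewrite wact_cons mcoeff_act_letterM.
Qed.

Lemma wact_letter h (w : word) y : (@wact K gT M h w)@_(FMonom [:: y]) =
  (if fmonom_val w is [:: z] then yd_act h z y else 0).
Proof.
case: w => [[|x w]]; first by rewrite /wact big_nil mcoeff1E.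
rewrite wact_cons mcoeff_act_letterM /= wact_nil /=.
by case: w => [|z w]; rewrite ?mulr1 ?mulr0.
Qed.

Lemma wdeg_letter (x : X) : wdeg (fmu x) = yd_deg x.
Proof. by rewrite /wdeg fmuE /= big_seq1. Qed.

Lemma part_bmul m p B :
  part m (ext (bmul p) B) = ext (fun q : word * word =>
    (<< p.1 >> * @wact K gT M (wdeg p.2) q.1)@_m *: (<< p.2 >> * << q.2 >>)) B.
Proof.
by rewrite ext_comp; apply: eq_ext => q; rewrite /= /bmul part_tens.
Qed.

Lemma part_wcomul m x (w : seq X) : part m (@wcomul K gT M (FMonom (x :: w))) =
  ext (fun q : word * word =>
    (<< fmu x >> * @wact K gT M (@wdeg K gT M mone) q.1)@_m *:
      (<< mone >> * << q.2 >>))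
    (@wcomul K gT M (FMonom w)) +
  ext (fun q : word * word =>
    (<< mone >> * @wact K gT M (wdeg (fmu x)) q.1)@_m *:
      (<< fmu x >> * << q.2 >>))
    (@wcomul K gT M (FMonom w)).
Proof.
apply: etrans (congr1 (part m) (wcomul_cons x w)) _.
apply: etrans (partD _ _ _) _.
exact: (congr2 +%R (part_bmul _ _ _) (part_bmul _ _ _)).
Qed.

(** The counit axiom. *)
Lemma part_nil (w : seq X) :
  part (FMonom [::]) (@wcomul K gT M (FMonom w)) = << FMonom w >>.
Proof.
elim: w => [|x w IHw].
  rewrite part_tens mcoeff1E scale1r.
  by congr (<< _ >>); rewrite -[mone]/(fmone _) fmoneE.
rewrite part_wcomul -(gen_word x w) -IHw.
rewrite -[RHS]add0r; apply: (congr2 +%R).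
  by apply: ext0 => q /=; rewrite mcoeff_genM scale0r.
rewrite -ext_mulr; apply: eq_ext => q /=; rewrite mul1r wact_nil fmP /=.
by case: eqP; rewrite ?scale1r ?scale0r ?mulr0.
Qed.

(** The component of degree one in the first factor of the coproduct obeys a
    Leibniz rule.  When y is fixed up to scalar by the degree of x and occurs in
    no other image, only one term of the action contributes. *)
Lemma part_letter x y c (w : seq X) :
  (forall z, yd_act (yd_deg x) z y = if z == y then c else 0) ->
  part (FMonom [:: y]) (@wcomul K gT M (FMonom (x :: w))) =
  (x == y)%:R *: << FMonom w >> +
  c *: (<< fmu x >> * part (FMonom [:: y]) (@wcomul K gT M (FMonom w))).
Proof.
move=> hc; rewrite part_wcomul -part_nil; apply: (congr2 +%R).
  rewrite ext_scale; apply: eq_ext => q /=.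
  rewrite mcoeff_genM /= wact_nil fmP /= mul1r.
  move: (<< q.2 >> : T) => gq.
  by case: eqP => _; case: eqP => _ /=;
    rewrite ?mulr1 ?mulr0 ?scale1r ?scale0r ?scaler0.
rewrite -ext_mulr.
rewrite ext_scale; apply: eq_ext => q /=.
rewrite mul1r wact_letter wdeg_letter fmP /=.
move: (<< fmu x >> : T) (<< q.2 >> : T) => gx gq.
have Z : 0 *: (gx * gq) = c *: (gx * 0) by rewrite (mulr0 gx) scale0r scaler0.
case: (fmonom_val q.1) => [|z [|z' s]]; first exact: Z.
  by rewrite hc eqseq_cons eqxx andbT; case: (z == y); [reflexivity|exact: Z].
by rewrite eqseq_cons [_ :: _ == _]/= andbF; exact: Z.
Qed.

(** The skew derivation by y: the part of the coproduct of the form y (x) _. *)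
Definition skew y (a : T) : T := part (FMonom [:: y]) (comul a).

Lemma skew_is_linear y : linear (skew y).
Proof.
move=> c a b; rewrite /skew !comulE.
apply: etrans (congr1 _ (ext_is_linear _ _ _ _)) _; exact: part_is_linear.
Qed.

Lemma skewU y w : skew y << w >> = part (FMonom [:: y]) (@wcomul K gT M w).
Proof. exact: congr1 _ (ext1 _ _). Qed.

(** Of the two kinds of terms in the coproduct of an element of I, those with
    first factor in I have no component of degree one there. *)
Lemma skew_ideal (I : T -> Prop) y a :
  homogeneous_coideal I -> I a -> I (skew y a).
Proof.
move=> hI /(hc_comul hI)[r [hr E]]; rewrite /skew E.
have scaleI c b : I b -> I (c *: b).
  by move=> Ib; rewrite -[_ *: _]addr0; apply: (hc_lin hI) => //;
    exact: hc_zero hI.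
elim: r hr {E} => [|[b c] r IHr] hr.
  by rewrite big_nil part0; exact: hc_zero hI.
rewrite big_cons partD -[part _ (tens _ _)]scale1r; apply: (hc_lin hI);
  last first.
  by apply: IHr => q qr; apply: hr; rewrite inE qr orbT.
rewrite part_tens; have [Ib|Ic] := hr _ (mem_head _ _); last exact: scaleI.
rewrite mcoeff_outdom ?scale0r; first exact: hc_zero hI.
by apply/negP => /(hc_deg hI Ib); rewrite fdegE.
Qed.

Section Letters.
Variables (I : eqType) (p : I -> I -> K) (ell : I -> X).
Hypothesis ell_inj : injective ell.
Hypothesis ell_act : forall i j z,
  yd_act (yd_deg (ell i)) z (ell j) = if z == ell j then p i j else 0.

Definition ell_word (u : seq I) : T := << FMonom (map ell u) >>.

(** On words in letters spanning a diagonal braided subspace, the skew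
    derivations are those of the shuffle model. *)
Lemma skew_word j u :
  skew (ell j) (ell_word u) = \sum_(t <- der_word p j u) t.1 *: ell_word t.2.
Proof.
rewrite /ell_word skewU; elim: u => [|i u IHu].
  by rewrite big_nil part_tens mcoeff1E scale0r.
rewrite [der_word _ _ _]/= big_cat big_map (part_letter _ (ell_act i j)) IHu.
apply: (congr2 +%R).
  by rewrite (inj_eq ell_inj); case: eqP => _;
    rewrite ?big_seq1 ?big_nil // scale0r.
rewrite mulr_sumr scaler_sumr; apply: eq_bigr => t _.
by rewrite malg_mulrZ scalerA gen_word.
Qed.

(** A pairing of T(M) with words whose radical contains the defining ideal. *)
Fixpoint pairing (w : seq I) (a : T) : K :=
  if w is j :: w' then pairing w' (skew (ell j) a) else a@_(FMonom [::]).

Lemma pairing_linear w c a b : pairing w (c *: a + b) =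
  c * pairing w a + pairing w b.
Proof.
elim: w a b => [|j w IHw] a b /=; first by rewrite mcoeffD mcoeffZ.
by rewrite skew_is_linear IHw.
Qed.

Lemma pairing0 w : pairing w 0 = 0.
Proof.
have := pairing_linear w 1 0 0; rewrite scaler0 addr0 mul1r => /eqP.
by rewrite -subr_eq0 opprD addNKr oppr_eq0 => /eqP.
Qed.

Lemma pairing_sum w (J : Type) (r : seq J) (c : J -> K) (f : J -> T) :
  pairing w (\sum_(x <- r) c x *: f x) = \sum_(x <- r) c x * pairing w (f x).
Proof.
elim: r => [|x r IHr]; first by rewrite !big_nil pairing0.
by rewrite !big_cons pairing_linear IHr.
Qed.

Lemma pairing_word w u : pairing w (ell_word u) =
  word_op (shuf p) u (@unit_fn K I) w.
Proof.
elim: w u => [|j w IHw] u.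
  rewrite [LHS]/= /ell_word mcoeffU1 fmP /= -/(nilp _).
  by case: u => [|i u] //=; rewrite shuf_nil.
rewrite [LHS]/= skew_word pairing_sum -[RHS]/(lder j
  (word_op (shuf p) u (@unit_fn K I)) w).
rewrite (leibniz_word (lin_shuf p) (lder_shuf p ^~ j))
  (_ : lder j (@unit_fn K I) = fun=> 0) //.
rewrite (lin0 (lin_word_op _ (lin_shuf p))) /comb mul1r mulr0 addr0 /poly_op.
by apply: eq_bigr => t _; rewrite IHw.
Qed.

(** Elements of the defining ideal have no constant term, and neither have
    their skew derivatives. *)
Lemma pairing_ideal w a : nichols_ideal a -> pairing w a = 0.
Proof.
have lamI (J : T -> Prop) b : homogeneous_coideal J -> J b -> pairing w b = 0.
  move=> hJ; elim: w b => [|j v IHv] b Jb /=; last by apply: IHv;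
    exact: skew_ideal.
  by apply: mcoeff_outdom; apply/negP => /(hc_deg hJ Jb); rewrite fdegE.
move=> [r [hr ->]]; elim: r hr => [|b r IHr] hr;
  first by rewrite big_nil pairing0.
rewrite big_cons -[b]scale1r pairing_linear IHr ?addr0; last first.
  by move=> q qr; apply: hr; rewrite inE qr orbT.
by have [J [hJ Jb]] := hr b (mem_head _ _); rewrite (lamI J) ?mulr0.
Qed.

Lemma word_op_size u w : size u != size w ->
  word_op (shuf p) u (@unit_fn K I) w = 0.
Proof.
elim: w u => [|j w IHw] u uw.
  by case: u uw => [|i u] //=; rewrite shuf_nil.
rewrite -[LHS]/(lder j (word_op (shuf p) u (@unit_fn K I)) w).
rewrite (leibniz_word (lin_shuf p) (lder_shuf p ^~ j))
  (_ : lder j (@unit_fn K I) = fun=> 0) //.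
rewrite (lin0 (lin_word_op _ (lin_shuf p))) /comb mul1r mulr0 addr0 /poly_op.
rewrite big1_seq // => t /andP[_ /der_word_perm/perm_size ut].
by rewrite IHw ?mulr0 //; move: uw; rewrite ut.
Qed.

(** The suffixes of a nonzero word of length more than n are nonzero and of
    n + 1 different lengths.  The functionals detecting them have a diagonal
    invertible matrix, which would factor through the n generators of the
    quotient. *)
Lemma nichols_finite_bounded : nichols_findim M ->
  exists N, forall u, (N < size u)%N -> word_op (shuf p) u (@unit_fn K I) =
    fun=> 0.
Proof.
move=> [n [b hb]]; exists n => u un; apply: contrapT => u_neq0.
pose v (k : 'I_n.+1) := drop (size u - k) u.
have size_v k : size (v k) = k by rewrite size_drop subKn //;
  have := ltn_ord k; lia.
have [w hw] : exists w : 'I_n.+1 -> seq I, forall k,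
  word_op (shuf p) (v k) (@unit_fn K I) (w k) != 0.
  apply: (fin_all_exists (P :=
    fun k w => word_op (shuf p) (v k) (@unit_fn K I) w != 0)) => k.
  apply: contrapT => h; apply: u_neq0;
    rewrite -(cat_take_drop (size u - k) u) word_op_cat.
  rewrite -/(v k) (_ : word_op _ (v k) _ =
    fun=> 0) ?(lin0 (lin_word_op _ (lin_shuf p))) //.
  by apply: funext => x; apply: contrapT => hx; apply: h; exists x; apply/eqP.
pose A := \matrix_(k, l) pairing (w k) (ell_word (v l)).
have size_w k : size (w k) = k.
  by apply/eqP; apply: contraNT (hw k) => h;
    rewrite word_op_size ?eqxx // size_v eq_sym.
have AD : A = diag_mx (\row_k A k k).
  apply/matrixP => k l; rewrite !mxE; case: (eqVneq k l) => [->|kl];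
    first by rewrite mulr1n.
  by rewrite mulr0n pairing_word word_op_size // size_v size_w eq_sym.
have A_unit : A \in unitmx.
  rewrite AD unitmxE det_diag unitfE; apply/prodf_neq0 => k _.
  by rewrite !mxE pairing_word hw.
have [c hc] : exists c : 'I_n.+1 -> 'I_n -> K, forall l,
    nichols_ideal (ell_word (v l) - \sum_(i < n) c l i *: b i).
  by apply: (fin_all_exists (P := fun l cl =>
    nichols_ideal (ell_word (v l) - \sum_(i < n) cl i *: b i))) => l; apply: hb.
have AE : A = (\matrix_(k, i) pairing (w k) (b i)) *m (\matrix_(i, l) c l i).
  apply/matrixP => k l; rewrite !mxE.
  have := pairing_ideal (w k) (hc l);
    rewrite addrC -scaleN1r pairing_linear mulN1r pairing_sum.
  rewrite addrC => /eqP; rewrite subr_eq0 => /eqP ->.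
  by apply: eq_bigr => i _; rewrite !mxE mulrC.
move: AE; set B := (X in X *m _); set C := (X in _ *m X) => AE.
have := leq_trans (mxrankM_maxl B C) (rank_leq_col B).
by rewrite -AE mxrank_unit // ltnn.
Qed.
End Letters.
End Nichols.

(** * Powers of s in its conjugacy class *)

Lemma pairs2 (P : nat -> nat -> Prop) : P 0 1 ->
  forall i j, (i < j < 2)%N -> P i j.
Proof.
by move=> P01 [|i] [|[|j]] //; rewrite !ltnS // => /andP[].
Qed.

Lemma pairs3 (P : nat -> nat -> Prop) : P 0 1 -> P 0 2 -> P 1 2 ->
  forall i j, (i < j < 3)%N -> P i j.
Proof.
by move=> P01 P02 P12 [|[|i]] [|[|[|j]]] //; rewrite !ltnS // => /andP[].
Qed.

(** With trivial self-braiding, the value of x^n at the word of length n is n!,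
    which is nonzero in characteristic 0. *)
Lemma symmetric_unbounded (F : numFieldType) (p : 'I_1 -> 'I_1 -> F) N :
  p ord0 ord0 = 1 ->
  ~ (forall u, (N < size u)%N -> word_op (shuf p) u (@unit_fn F 'I_1) =
    fun=> 0).
Proof.
move=> p1 h.
have fact n : iter n (shuf p ord0) (@unit_fn F _) (nseq n ord0) = (n`!)%:R.
  elim: n => [|n IHn]; first by rewrite /unit_fn fact0.
  rewrite -[LHS]/(lder ord0 (iter n.+1 (shuf p ord0) (@unit_fn F 'I_1))
    (nseq n ord0)).
  rewrite lder_iter eqxx (_ : lder ord0 (@unit_fn F 'I_1) = fun=> 0) //.
  rewrite (lin0 (lin_iter _ (lin_shuf p _))) /comb mulr0 addr0 [X in X * _]/=
    IHn factS natrM.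
  congr (_ * _); rewrite /qint p1; under eq_bigr do rewrite expr1n.
  by rewrite sumr_const card_ord.
have := h (nseq N.+1 ord0); rewrite size_nseq ltnSn word_op_nseq => /(_ isT).
move/(congr1 (fun f => f (nseq N.+1 ord0))); rewrite fact => /eqP.
by rewrite pnatr_eq0 -leqn0 leqNgt fact_gt0.
Qed.

Section Class.
Variables (F : numClosedFieldType) (gT : finGroupType) (G : {group gT})
  (s : gT).
Variables (d : nat) (rho : mx_representation F 'C_G[s]%g d) (g : gT -> gT).
Hypotheses (sG : s \in G) (hg : coset_reps G s g) (d_gt0 : (0 < d)%N).
Variable q : F.
Hypothesis rho_s : rho s = q%:M.

Lemma s_cent : s \in 'C_G[s]%g.
Proof. by rewrite inE sG cent1id. Qed.

Lemma rho_sX n : rho (s ^+ n)%g = (q ^+ n)%:M.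
Proof.
elim: n => [|n IHn]; first by rewrite expg0 repr_mx1.
rewrite expgS repr_mxM ?groupX ?s_cent // IHn rho_s -scalar_mxM exprS //.
Qed.

Lemma expg_expr m n : (s ^+ m = s ^+ n)%g -> q ^+ m = q ^+ n.
Proof.
move=> e; have := rho_sX n;
  rewrite -e rho_sX => /matrixP/(_ (Ordinal d_gt0) (Ordinal d_gt0)).
by rewrite !mxE eqxx.
Qed.

Section Points.
Variables (n : nat) (b b' : 'I_n -> nat) (e : 'I_n -> 'I_d).
Hypothesis b_class : forall i, (s ^+ b i)%g \in (s ^: G)%g.
Hypothesis b_inv : forall i, (s ^+ (b i * b' i) = s)%g.
Hypothesis b_inj : injective (fun i => ((s ^+ b i)%g, e i)).

Definition point (i : 'I_n) : yd_basis (class_yd rho g) :=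
  (exist _ (s ^+ b i)%g (b_class i), e i).

Lemma point_inj : injective point.
Proof. by move=> i j [h1 h2]; apply: b_inj; rewrite /= h1 h2. Qed.

(** Conjugation by the coset representative of s^(b j) turns s into s^(b j), so
    it turns s^(b i b' j) into s^(b i). *)
Lemma point_act i j z : yd_act (yd_deg (point i)) z (point j) =
  if z == point j then q ^+ (b i * b' j) else 0.
Proof.
case: z => [[t tO] k]; rewrite /= ffunE /=.
have [gj_G gj] := hg (b_class j); have [gt_G gt] := hg tO.
set gj' := g (s ^+ b j)%g in gj gj_G *.
have sXG m : (s ^+ m)%g \in G by rewrite groupX.
have sb m k' : (s ^+ m * s ^+ k' = s ^+ k' * s ^+ m)%g by rewrite -!expgD addnC.
(* Powers of s commute, so s^(b i) maps the component over t to itself. *)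
have [tj|tj] := eqVneq t (s ^+ b j)%g; last first.
  rewrite ifN; first by rewrite ifN // xpair_eqE negb_and -val_eqE /= tj.
  apply: contra tj; rewrite inE => /andP[_ /cent1P h]; apply/eqP.
  apply: (mulgI (s ^+ b i)%g); rewrite sb -gt -[in RHS]gj.
  have := congr1 (fun x => gj' * x * (g t)^-1)%g h.
  by rewrite !mulgA mulgV mul1g mulgK.
have E : (gj'^-1 * (s ^+ b i * g t))%g = (s ^+ (b i * b' j))%g.
  rewrite tj -/gj'; apply: (mulgI gj'); rewrite mulKVg.
  rewrite -[in LHS](b_inv j) -expgM -mulnA expgM -[in LHS]gj.
  have -> : (gj' * s * gj'^-1 = s ^ gj'^-1)%g by rewrite conjgE invgK mulgA.
  by rewrite -conjXg conjgE invgK mulgA mulgKV [(b' j * _)%N]mulnC.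
rewrite E groupX ?s_cent // rho_sX mxE xpair_eqE /=.
rewrite (_ : exist _ t tO == _) /=; last by apply/eqP/val_inj.
by rewrite eq_sym; case: eqP.
Qed.

Lemma points_unbounded : nichols_findim (class_yd rho g) ->
  exists N, forall u, (N < size u)%N ->
    word_op (shuf (fun i j => q ^+ (b i * b' j))) u (@unit_fn F 'I_n) = fun=> 0.
Proof. exact: nichols_finite_bounded point_inj point_act. Qed.

End Points.

(** A point (b, b', e) of the list stands for the basis vector e over s^b, with
    b' an inverse of b. *)
Section PointList.
Variables (pts : seq (nat * nat * 'I_d)) (M a : nat).
Let e0 : 'I_d := Ordinal d_gt0.
Let pt i := nth (1%N, 1%N, e0) pts i.
Local Notation m := (size pts).

Lemma points_infinite : M.-primitive_root q -> (1 < M)%N ->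
  (a < M)%N -> (1 < m)%N -> (2 <= m.-1 * a)%N ->
  uniq [seq ((s ^+ t.1.1)%g, t.2) | t <- pts] ->
  {in pts, forall t, (s ^+ t.1.1)%g \in (s ^: G)%g /\ (s ^+ (t.1.1 * t.1.2) =
    s)%g} ->
  (forall i j, (i < j < m)%N ->
     q ^+ ((pt i).1.1 * (pt j).1.2 + (pt j).1.1 * (pt i).1.2 + a) = 1) ->
  ~ nichols_findim (class_yd rho g).
Proof.
move=> qM M1 aM m1 ma pU hp he.
have hpt (i : 'I_m) : pt i \in pts by apply: mem_nth.
have inj : injective (fun i : 'I_m => ((s ^+ (pt i).1.1)%g, (pt i).2)).
  move=> i j hij; apply: val_inj; apply/eqP.
  rewrite -(nth_uniq (1%g, e0) _ _ pU) ?size_map ?ltn_ord //.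
  by rewrite !(nth_map (1%N, 1%N, e0)) ?ltn_ord //; apply/eqP; exact: hij.
move/(@points_unbounded m (fun i => (pt i).1.1) (fun i => (pt i).1.2)
  (fun i => (pt i).2)
  (fun i => (hp _ (hpt i)).1) (fun i => (hp _ (hpt i)).2) inj) => [N hN].
pose k0 : 'I_m := Ordinal (ltnW m1).
have cart : cartan M (fun _ _ => a) q
    (fun i j : 'I_m => q ^+ ((pt i).1.1 * (pt j).1.2)).
  split=> // [k|k l|k l kl].
  - by rewrite (@expg_expr _ 1%N) // expg1; case: (hp _ (hpt k)).
  - by rewrite -exprM mulnC exprM (prim_expr_order qM) expr1n.
  rewrite -!exprD; case: (ltngtP k l) => h;
    last by rewrite (val_inj h) eqxx in kl.
    by rewrite he // h ltn_ord.
  by rewrite [(_ * _ + _ * _)%N]addnC he // h ltn_ord.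
apply: (cartan_infinite _ _ M1 _ k0 cart hN) => // k.
by rewrite sum_nat_const cardC1 card_ord.
Qed.
End PointList.

(** With u' an inverse of u, the letters over s and s^u have the product
    q^(u + u') of braidings, equal to q^(- a) for some a < M.  If a >= 2 these
    two letters are enough.  If a = 1, the letters over s, s^u and s^(u^2) form
    a triangle.  If a = 0, the letters over s and s^(u^2) have the product
    q^(u^2 + u'^2) = q^(-2).  The last two cases need s^(u^2) <> s, which fails
    only for M <= 3.  When M = 3, a second basis vector over s provides the
    missing letter if u = 1 modulo 3, and a = 2 if u = 2 modulo 3. *)
Lemma finite_class_order M : M.-primitive_root q -> (1 < M)%N ->
  nichols_findim (class_yd rho g) ->
  forall u, (s ^+ u)%g \in (s ^: G)%g -> (s ^+ u)%g != s ->
  (M <= 3)%N /\ (M = 3%N -> d = 1%N).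
Proof.
move=> qM M1 fin u sxu us.
have [u' uu'] : exists u', (s ^+ (u * u') = s)%g.
  have : s \in <[s ^+ u]>%g.
    have /eqP -> : <[s ^+ u]>%g == <[s]>%g; last exact: cycle_id.
    rewrite eqEcard cycleX -!orderE /=; case/imsetP: sxu => h _ ->.
    by rewrite orderJ.
  by case/cycleP => u' e; exists u'; rewrite expgM -e.
have suu_class : (s ^+ (u * u))%g \in (s ^: G)%g.
  case/imsetP: (sxu) => h hG e; rewrite expgM e -conjXg e -conjgM.
  by apply: memJ_class; rewrite groupM.
have E n : q ^+ (u * u' * n) = q ^+ n.
  by apply: expg_expr; rewrite expgM uu'.
have s1 : (s ^+ 1)%g \in (s ^: G)%g by rewrite expg1 class_refl.
have inj_mul x y : (s ^+ x = s ^+ y)%g -> (s ^+ (x * u') = s ^+ (y * u'))%g.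
  by move=> e; rewrite !expgM e.
pose e0 : 'I_d := Ordinal d_gt0.
have pow1 x : (q ^+ x == 1) = (M %| x)%N by rewrite (prim_order_dvd qM).
have qMx x y z : (x + y * M = z * M)%N -> q ^+ x = 1.
  move=> h; apply/eqP; rewrite pow1 -(dvdn_addl _ (dvdn_mull y (dvdnn M))) h.
  exact: dvdn_mull.
have [k hk] : exists k, (u * u' = k * M + 1)%N.
  exists (u * u' %/ M)%N; rewrite {1}(divn_eq (u * u') M); congr (_ + _)%N.
  have /eqP := E 1%N; rewrite muln1 (eq_prim_root_expr qM) => /eqP.
  by rewrite [(1 %% M)%N]modn_small.
have suuI : (s ^+ (u * u) = s)%g -> q ^+ u = q ^+ u'.
  move=> h; rewrite -E mulnAC mulnC; apply: expg_expr.
  by rewrite mulnC expgM h.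
have pt1 : (s ^+ 1)%g \in (s ^: G)%g /\ (s ^+ (1 * 1))%g = s by rewrite expg1.
have ptuu : (s ^+ (u * u))%g \in (s ^: G)%g /\ (s ^+ (u * u * (u' * u')))%g = s.
  by split=> //; rewrite mulnACA expgM !uu'.
have M_le3 : (M <= 3)%N.
  rewrite leqNgt; apply/negP => M3.
  pose a := ((M - (u + u') %% M) %% M)%N.
  have aM : (a < M)%N by rewrite ltn_mod; lia.
  have [c hc] : exists c, (u + u' + a = c * M)%N.
    apply/dvdnP; rewrite /dvdn -modnDml modnDmr subnKC ?modnn //.
    by apply/ltnW; rewrite ltn_mod; lia.
  (* As u + u' = c M - a and u u' = k M + 1, each exponent below becomes a
     multiple of M after adding one; both quotients are passed to [qMx]. *)
  clearbody a; case: (ltngtP a 1) => a1.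
  - have a0 : a = 0%N by lia.
    rewrite a0 addn0 in hc.
    apply: (@points_infinite [:: (1, 1, e0);
      (u * u, u' * u', e0)]%N M 2) fin => //=.
    + by lia.
    + rewrite inE xpair_eqE eqxx andbT andbT eq_sym expg1; apply/eqP => /suuI h.
      have : (q ^+ 2 == 1).
        rewrite -E (_ : u * u' * 2 = (u + u) * u')%N; last by lia.
        rewrite exprM exprD {2}h -exprD (qMx _ 0%N c) ?expr1n //.
        by rewrite addn0.
      rewrite pow1 => /dvdn_leq; lia.
    + by move=> t; rewrite !inE => /orP[] /eqP->.
    apply: pairs2 => /=; apply: (qMx _ (2 * k)%N (c * c * M)%N).
    have : ((u + u') * (u + u') = c * M * (c * M))%N by rewrite hc.
    by nia.
  - apply: (@points_infinite [:: (1, 1, e0); (u, u', e0)]%N M a) fin => //=.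
    + by lia.
    + by rewrite inE xpair_eqE eqxx andbT andbT eq_sym expg1.
    + by move=> t; rewrite !inE => /orP[] /eqP->.
    apply: pairs2 => /=; apply: (qMx _ 0%N c); lia.
  subst a.
  apply: (@points_infinite [:: (1, 1, e0); (u, u', e0);
    (u * u, u' * u', e0)]%N M 1) fin => //=.
  + rewrite !inE !xpair_eqE !eqxx !andbT expg1 negb_or eq_sym us /=.
    apply/andP; split; last first.
      apply: contra us => /eqP h; apply/eqP; have := inj_mul _ _ h.
      by rewrite uu' [(u * u * u')%N]mulnAC expgM uu' => <-.
    apply/eqP => /esym /suuI h.
    have h1 : q ^+ (u + u' + 1) = 1 by apply: (qMx _ 0%N c); rewrite hc addn0.
    have h2 : q ^+ (u' + 2) = 1.
      have : q ^+ (u + u + 1) = 1 by move: h1; rewrite !exprD h.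
      move/(congr1 (fun x => x ^+ u')); rewrite expr1n -exprM.
      rewrite (_ : (u + u + 1) * u' = u * u' * 2 + u')%N; last by lia.
      by rewrite exprD E -exprD addnC.
    have : q ^+ 3 == 1.
      have : q ^+ (u' + u' + 1) = 1 by move: h1; rewrite !exprD h.
      move=> h3; rewrite -[_ ^+ 3]mul1r -[X in X * _]h3 -exprD.
      rewrite (_ : u' + u' + 1 + 3 = (u' + 2) + (u' + 2))%N; last by lia.
      by rewrite exprD h2 mulr1.
    by rewrite pow1 => /dvdn_leq; lia.
  + by move=> t; rewrite !inE => /or3P[] /eqP->.
  apply: pairs3 => /=.
  + by apply: (qMx _ 0%N c); lia.
  + apply: (qMx _ (2 * k + 2 * c)%N (c * c * M)%N).
    have : ((u + u' + 1) * (u + u' + 1) = c * M * (c * M))%N by rewrite hc.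
    by nia.
  by apply: (qMx _ 0%N (k * (u + u') + c)%N); nia.
split=> // M3; apply/eqP; rewrite eqn_leq d_gt0 andbT leqNgt; apply/negP => d1.
pose e1 : 'I_d := Ordinal d1.
subst M; have := ltn_pmod u (isT : 0 < 3)%N; have := divn_eq u 3.
move: (u %/ 3)%N (u %% 3)%N => v [|[|[|//]]] hu _.
- by move: hk; rewrite hu; lia.
- apply: (@points_infinite [:: (1, 1, e0); (1, 1, e1);
  (u, u', e0)]%N 3 1) fin => //=.
  + by rewrite !inE !xpair_eqE !eqxx !andbT expg1 eq_sym [s == _]eq_sym
    (negPf us).
  + by move=> t; rewrite !inE => /or3P[] /eqP->.
  have hE : q ^+ (u + u' + 1) = 1.
    by apply: (qMx _ (v * u')%N (k + v + 1)%N); move: hk; rewrite hu; nia.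
  apply: pairs3; rewrite ?mul1n ?muln1.
  + by apply: (qMx _ 0%N 1%N).
  + by rewrite [(u' + u)%N]addnC.
  by rewrite [(u' + u)%N]addnC.
apply: (@points_infinite [:: (1, 1, e0); (u, u', e0)]%N 3 2) fin => //=.
+ by rewrite inE xpair_eqE eqxx andbT andbT eq_sym expg1.
+ by move=> t; rewrite !inE => /orP[] /eqP->.
apply: pairs2 => /=; rewrite mul1n muln1.
by apply: (qMx _ (u' + 2 * (v * u'))%N (2 * k + v + 2)%N); move: hk;
  rewrite hu; nia.
Qed.
End Class.

Lemma irr_dim_gt0 (K : fieldType) (gT : finGroupType) (H : {group gT}) d
  (rho : mx_representation K H d) : mx_irreducible rho -> (0 < d)%N.
Proof.
by case=> _ h _; case: d rho h => // rho; rewrite flatmx0 eqxx.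
Qed.

Lemma central_scalar (K : closedFieldType) (gT : finGroupType) (H : {group gT})
    d (rho : mx_representation K H d) z :
  mx_irreducible rho -> z \in H -> {in H, forall x, commute z x} ->
  exists q, rho z = q%:M.
Proof.
move=> irr zH zC; apply/is_scalar_mxP.
apply: mx_abs_irr_cent_scalar (group_closure_closed_field irr) _ _.
by apply/centgmxP => x xH; rewrite -!repr_mxM // zC.
Qed.

Lemma zexpg_exp (gT : finGroupType) (s : gT) (j : int) :
  exists u : nat, zexpg s j = (s ^+ u)%g.
Proof.
suff : zexpg s j \in <[s]>%g by case/cycleP => u ->; exists u.
by case: j => n; rewrite /= ?groupV mem_cycle.
Qed.

Theorem lemma2p1 (R : realType) (gT : finGroupType) (G : {group gT}) (s : gT)
    (d : nat) (rho : mx_representation R[i] 'C_G[s]%g d) (g : gT -> gT) :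
  s \in G ->
  quasi_real G s ->
  mx_irreducible rho ->
  coset_reps G s g ->
  ~ quasi_minus1_type rho ->
  ~ nichols_findim (class_yd rho g).
Proof.
move=> sG qr irr hg not_type fin.
have d_gt0 := irr_dim_gt0 irr.
have [q rho_s] : exists q, rho s = q%:M.
  apply: (central_scalar irr) (s_cent sG) _ => x.
  by rewrite inE => /andP[_ /cent1P].
have qX x y := @expg_expr _ _ _ _ _ _ sG d_gt0 _ rho_s x y.
have [M qM Mdvd] : {M | M.-primitive_root q & (M %| #[s]%g)%N}.
  apply: prim_order_exists; first exact: order_gt0.
  by rewrite (qX _ 0%N) ?expr0 // expg_order expg0.
have M0 := prim_order_gt0 qM.
have M_neq1 : M != 1%N.
  apply/eqP => M1.
  have q1 : q = 1 by have := prim_expr_order qM; rewrite M1 expr1.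
  have [|||N hN] := points_unbounded sG hg rho_s (n := 1) (b := fun=> 1%N)
    (b' := fun=> 1%N) (e := fun=> Ordinal d_gt0) _ _ _ fin.
  - by move=> _; rewrite expg1 class_refl.
  - by move=> _; rewrite expg1.
  - by move=> i j _; rewrite !ord1.
  by apply: (symmetric_unbounded _ hN); rewrite q1 expr1n.
have M_neq2 : M != 2%N.
  apply/eqP => M2; apply: not_type; exists q; split=> //.
  have even : ~~ odd #[s]%g by rewrite -dvdn2 -M2.
  have qN1 : q = -1.
    have := prim_expr_order qM; rewrite M2 => /eqP;
      rewrite sqrf_eq1 => /orP[]/eqP// q1.
    have := prim_order_dvd qM 1; rewrite expr1 q1 eqxx M2 //.
  case: (ltngtP d 1) d_gt0 => [|d1|d1] // _; first by constructor 2.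
  by constructor 3.
have M_gt1 : (1 < M)%N by move: M0 M_neq1; case: (M) => [|[]].
have [s2|[j [sj sjs]]] := qr.
  have : q ^+ 2 = 1 by rewrite (qX _ 0%N) ?expr0 // s2 expg0.
  move=> /eqP; rewrite -(prim_order_dvd qM) => /dvdn_leq; lia.
have [u ju] := zexpg_exp s j.
rewrite ju in sj; move/eqP: sjs; rewrite ju => su.
have [M3 d1] := finite_class_order sG hg d_gt0 rho_s qM M_gt1 fin sj su.
apply: not_type; exists q; split=> //; constructor 4.
have M3' : M = 3%N by lia.
by split; [exact: d1|rewrite -M3'].
Qed.
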